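(* Let $\Lambda\subset\Gamma$ be Fitting orders over a Fitting domain $\mathfrak{o}$ in an algebra $A$, and let $M$ be a finitely generated $\Lambda$-module. Suppose that $\Gamma$ is nice. Then $$\mathcal{F}(\Gamma,\Lambda)\cdot\mathrm{Fit}^{\max}_{\Lambda}(M)\subset\mathcal{F}(\Gamma,\Lambda)\cdot\mathrm{Fit}^{\max}_{\Gamma}(\Gamma\otimes_{\Lambda}M)\subset\mathrm{Ann}_{\zeta(\Lambda)}(M).$$
   Context: Modules are left modules; $\zeta(\cdot)$ denotes the centre of a ring. A Fitting domain is an integrally closed complete commutative noetherian local domain $\mathfrak{o}$; let $F$ be its field of quotients. A Fitting order over $\mathfrak{o}$ is an $\mathfrak{o}$-order in a (finite dimensional) separable $F$-algebra $A$. A Fitting order $\Gamma$ over $\mathfrak{o}$ is nice if $\Gamma = \bigoplus_{j=1}^k \Gamma_j$ where each $\Gamma_j$ is either a maximal $\mathfrak{o}$-order or of the form $M_{a_j\times a_j}(R_j)$ for some commutative ring $R_j$. The central conductor is $\mathcal{F}(\Gamma,\Lambda) := \{x\in\zeta(\Gamma)\mid x\Gamma\subset\Lambda\}$. The reduced norm $\mathrm{nr}: M_{b\times b}(A)\to\zeta(A)$ is defined componentwise on the simple components of $A$. For a Fitting order $\Lambda$ put $\mathcal{U}(\Lambda) := \langle \mathrm{nr}(H) \mid H \in \mathrm{GL}_b(\Lambda), b\in\mathbb{N}\rangle_{\zeta(\Lambda)} \subset \zeta(A)$, the $\zeta(\Lambda)$-span. For a finite presentation $\Lambda^a \xrightarrow{h}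 \Lambda^b \twoheadrightarrow M$, identify $h$ with a matrix in $M_{a\times b}(\Lambda)$ (acting by right multiplication on row vectors), let $S_b(h)$ be the set of its $b\times b$ submatrices when $a\ge b$, and put $\mathrm{Fit}_\Lambda(h) := \langle \mathrm{nr}(H) \mid H\in S_b(h)\rangle_{\mathcal{U}(\Lambda)}$ if $a\ge b$ and $\mathrm{Fit}_\Lambda(h) := 0$ if $a<b$. Then $\mathrm{Fit}^{\max}_\Lambda(M)$ is the unique maximal element with respect to inclusion (which exists) among all $\mathrm{Fit}_\Lambda(h)$, $h$ running through the finite presentations of $M$; likewise for $\Gamma$. *)

(* Defs.v *)
From HB Require Import structures.
From mathcomp Require Import all_boot all_order all_algebra all_field.
From mathcomp Require Import boolp classical_sets.

Set Implicit Arguments.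
Unset Strict Implicit.
Unset Printing Implicit Defensive.

Import GRing.Theory.
Local Open Scope classical_set_scope.
Local Open Scope ring_scope.

(* The set of finite sums of products c * g with c in C and g in G.  If G is   *)
(* arbitrary this is the C-span of G; if C and G are additive subgroups        *)
(* (e.g. ideals) it is their product C.G.                                      *)
Definition ring_span (R : pzRingType) (C G : set R) : set R :=
  [set x | exists (n : nat) (c g : 'I_n -> R),
     (forall i, C (c i) /\ G (g i)) /\ x = \sum_i c i * g i].

Section FittingDomain.
Variable o : idomainType.

Definition is_ideal (I : set o) : Prop :=
  [/\ I 0, forall x y, I x -> I y -> I (x + y) & forall a x, I x -> I (a * x)].

Definition is_maximal_ideal (m : set o) : Prop :=
  [/\ is_ideal m, ~ m 1 &
      forall J, is_ideal J -> m `<=` J -> ~ J 1 -> J = m].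

Definition is_local_with (m : set o) : Prop :=
  is_maximal_ideal m /\ (forall J, is_maximal_ideal J -> J = m).

Definition noetherian : Prop :=
  forall I, is_ideal I -> exists s : seq o, I = ring_span setT [set` s].

Definition ideal_pow (m : set o) (n : nat) : set o := iter n (ring_span m) setT.

Definition adic_complete (m : set o) : Prop :=
  (forall x, (forall n, ideal_pow m n x) -> x = 0) /\
  (forall s : nat -> o,
     (forall n, exists N, forall i j, (N <= i)%N -> (N <= j)%N ->
        ideal_pow m n (s i - s j)) ->
     exists l, forall n, exists N, forall i, (N <= i)%N ->
        ideal_pow m n (s i - l)).

Definition integrally_closed : Prop :=
  forall x : {fraction o},
    integralOver (@tofrac o) x -> exists y : o, x = tofrac y.

Definition Fitting_domain : Prop :=
  [/\ noetherian, integrally_closed &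
      exists m, is_local_with m /\ adic_complete m].

End FittingDomain.

Section Algebra.
Variables (F : fieldType) (A : falgType F).

Definition semisimple_algebra : Prop :=
  forall U : {vspace A}, ({:A} * U <= U)%VS ->
    exists V : {vspace A},
      [/\ ({:A} * V <= V)%VS, (U + V)%VS = {:A}%VS & (U :&: V)%VS = 0%VS].

Definition central_idempotent (e : A) : Prop :=
  e \in 'Z({:A})%VS /\ e * e = e.

(* For A semisimple, the simple components of A are the ideals A * e, with e   *)
(* a primitive central idempotent; the centre of A * e is the field 'Z(A) * e. *)
Definition primitive_central_idempotent (e : A) : Prop :=
  [/\ central_idempotent e, e <> 0 &
      forall f, central_idempotent f -> f * e = f -> f = 0 \/ f = e].

(* A is semisimple and the centre of each simple component is separable over   *)
(* F.  As e is the unit of A * e, the value of p at x * e in A * e is p(x) * e. *)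
Definition separable_algebra : Prop :=
  semisimple_algebra /\
  (forall e, primitive_central_idempotent e ->
   forall x, x \in 'Z({:A})%VS ->
   exists p : {poly F}, separable_poly p /\ horner_alg x p * e = 0).

(* With K := 'Z(A) * e, a ring morphism rho with rho e = 1 factors through     *)
(* A * e.  If rho(A) spans 'M[L]_n.+1 over L, then rho maps K to scalar         *)
(* matrices, so that L is an extension of K, and the map induced from the      *)
(* simple algebra L (x)_K (A * e) to 'M[L]_n.+1 is an isomorphism: L splits     *)
(* A * e, and every splitting arises in this way.                              *)
Definition is_splitting (e : A) (L : fieldType) (n : nat)
    (rho : {rmorphism A -> 'M[L]_n.+1}) : Prop :=
  rho e = 1 /\
  (forall X : 'M[L]_n.+1, exists (r : nat) (c : 'I_r -> L) (x : 'I_r -> A),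
     X = \sum_i c i *: rho (x i)).

(* z is the reduced norm of H: in each simple component A * e, the image of z  *)
(* is the determinant of the image of H under a splitting of 'M_b(A * e).      *)
Definition is_nr (b : nat) (H : 'M[A]_b) (z : A) : Prop :=
  z \in 'Z({:A})%VS /\
  (forall e, primitive_central_idempotent e ->
   forall (L : fieldType) (n : nat) (rho : {rmorphism A -> 'M[L]_n.+1}),
     is_splitting e rho ->
     rho z = (\det (\mxblock_(i < b, j < b) rho (H i j)))%:M).

Definition nr (b : nat) (H : 'M[A]_b) : A := xget 0 [set z | is_nr H z].

End Algebra.

Section Subring.
Variables (A : nzRingType) (S : subringClosed A).

Record subring := Subring { subring_val : A; _ : subring_val \in S }.

HB.instance Definition _ := [isSub for subring_val].
HB.instance Definition _ := [Choice of subring by <:].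
HB.instance Definition _ := [SubChoice_isSubNzRing of subring by <:].

Definition centre : set A := [set x | x \in S /\ forall y, y \in S -> x * y = y * x].

End Subring.

Section Inclusion.
Variables (A : nzRingType) (S T : subringClosed A) (sST : {subset S <= T}).

Definition incl (x : subring S) : subring T := Subring (sST (valP x)).

Fact incl_is_zmod_morphism : zmod_morphism incl.
Proof. by move=> x y; apply: val_inj. Qed.

Fact incl_is_monoid_morphism : monoid_morphism incl.
Proof. by split=> [|x y]; apply: val_inj. Qed.

HB.instance Definition _ :=
  GRing.isZmodMorphism.Build (subring S) (subring T) incl incl_is_zmod_morphism.
HB.instance Definition _ :=
  GRing.isMonoidMorphism.Build (subring S) (subring T) incl
    incl_is_monoid_morphism.

End Inclusion.

(* Extension of scalars S (x)_R M along f : R -> S.  A finite sum of pure      *)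
(* tensors is represented by the sequence of its terms, modulo the congruence  *)
(* generated by commutativity, biadditivity and R-balancedness.                *)
Section Tensor.
Variables (R S : nzRingType) (f : {rmorphism R -> S}) (M : lmodType R).

Inductive tens_eq : seq (S * M) -> seq (S * M) -> Prop :=
| tens_refl s : tens_eq s s
| tens_sym s t : tens_eq s t -> tens_eq t s
| tens_trans s t u : tens_eq s t -> tens_eq t u -> tens_eq s u
| tens_cat s s' t t' : tens_eq s s' -> tens_eq t t' -> tens_eq (s ++ t) (s' ++ t')
| tens_comm s t : tens_eq (s ++ t) (t ++ s)
| tens_0l m : tens_eq [:: (0, m)] [::]
| tens_Dl a b m : tens_eq [:: (a + b, m)] [:: (a, m); (b, m)]
| tens_Dr a m n : tens_eq [:: (a, m + n)] [:: (a, m); (a, n)]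
| tens_bal a r m : tens_eq [:: (a * f r, m)] [:: (a, r *: m)].

Definition tens_eqb (s t : seq (S * M)) : bool := `[< tens_eq s t >].

Fact tens_eqb_refl : reflexive tens_eqb.
Proof. by move=> s; apply/asboolP; constructor. Qed.

Fact tens_eqb_sym : symmetric tens_eqb.
Proof. by move=> s t; apply/asboolP/asboolP; apply: tens_sym. Qed.

Fact tens_eqb_trans : transitive tens_eqb.
Proof.
by move=> t s u /asboolP st /asboolP tu; apply/asboolP; apply: tens_trans tu.
Qed.

Canonical tens_equiv := EquivRel tens_eqb tens_eqb_refl tens_eqb_sym tens_eqb_trans.

Definition tensor := {eq_quot tens_equiv}%qT.

HB.instance Definition _ := Choice.on tensor.
HB.instance Definition _ := EqQuotient.on tensor.

Definition tens_class (s : seq (S * M)) : tensor := (\pi_tensor s)%qT.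

Fact tens_classP s t : tens_class s = tens_class t <-> tens_eq s t.
Proof.
split=> [/eqquotP/asboolP // | st].
by apply/eqquotP/asboolP.
Qed.

Fact tens_class_repr (x : tensor) : tens_class (repr x) = x.
Proof. exact: reprK. Qed.

Fact repr_tens_class s : tens_eq (repr (tens_class s)) s.
Proof. by apply/tens_classP; rewrite tens_class_repr. Qed.

Definition tens_zero : tensor := tens_class [::].
Definition tens_add (x y : tensor) : tensor := tens_class (repr x ++ repr y).
Definition tens_scale (a : S) (x : tensor) : tensor :=
  tens_class [seq (a * p.1, p.2) | p <- repr x].
Definition tens_opp : tensor -> tensor := tens_scale (-1).

Fact tens_addE s t : tens_add (tens_class s) (tens_class t) = tens_class (s ++ t).
Proof. by apply/tens_classP/tens_cat; apply: repr_tens_class. Qed.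

Fact tens_scale_subproof a s t : tens_eq s t ->
  tens_eq [seq (a * p.1, p.2) | p <- s] [seq (a * p.1, p.2) | p <- t].
Proof.
elim=> {s t} [s|s t _|s t u _ H1 _ H2|s s' t t' _ H1 _ H2|s t|m|b c m|b m n|b r m] /=.
- exact: tens_refl.
- exact: tens_sym.
- exact: tens_trans H1 H2.
- by rewrite !map_cat; apply: tens_cat.
- by rewrite !map_cat; apply: tens_comm.
- by rewrite mulr0; apply: tens_0l.
- by rewrite mulrDr; apply: tens_Dl.
- exact: tens_Dr.
- by rewrite mulrA; apply: tens_bal.
Qed.

Fact tens_scaleE a s :
  tens_scale a (tens_class s) = tens_class [seq (a * p.1, p.2) | p <- s].
Proof. by apply/tens_classP/tens_scale_subproof/repr_tens_class. Qed.

Fact tens_ind (P : tensor -> Prop) : (forall s, P (tens_class s)) -> forall x, P x.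
Proof. by move=> Pc x; rewrite -[x]tens_class_repr. Qed.

Fact tens_addA : associative tens_add.
Proof.
by do 3![elim/tens_ind => ?]; rewrite !tens_addE catA.
Qed.

Fact tens_addC : commutative tens_add.
Proof.
by do 2![elim/tens_ind => ?]; rewrite !tens_addE; apply/tens_classP/tens_comm.
Qed.

Fact tens_add0 : left_id tens_zero tens_add.
Proof. by elim/tens_ind => s; rewrite tens_addE. Qed.

Fact tens_scale_class0 s : tens_eq [seq (0 * p.1, p.2) | p <- s] [::].
Proof.
elim: s => [|p s IHs] /=; first exact: tens_refl.
by rewrite mul0r; apply: (@tens_cat [:: _] [::] _ [::]) => //; apply: tens_0l.
Qed.

Fact tens_scaleDl_class a b s :
  tens_eq [seq ((a + b) * p.1, p.2) | p <- s]
          ([seq (a * p.1, p.2) | p <- s] ++ [seq (b * p.1, p.2) | p <- s]).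
Proof.
elim: s => [|[c m] s IHs] /=; first exact: tens_refl.
rewrite mulrDl.
set sa := map _ s in IHs *; set sb := [seq (a * _, _) | _ <- _] in IHs *.
set sc := [seq (b * _, _) | _ <- _] in IHs *.
apply: tens_trans (_ : tens_eq ([:: (a * c, m); (b * c, m)] ++ (sb ++ sc)) _).
  by apply: (@tens_cat [:: _]) => //; apply: tens_Dl.
rewrite -[_ :: _ ++ _]/([:: (a * c, m)] ++ (sb ++ ([:: (b * c, m)] ++ sc))).
rewrite -[X in X ++ (sb ++ sc)]/([:: (a * c, m)] ++ [:: (b * c, m)]) -!catA.
apply: tens_cat; first exact: tens_refl.
by rewrite !catA; apply: tens_cat; [exact: tens_comm | exact: tens_refl].
Qed.

Fact tens_scaleDl x a b :
  tens_scale (a + b) x = tens_add (tens_scale a x) (tens_scale b x).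
Proof.
elim/tens_ind: x => s; rewrite !tens_scaleE tens_addE.
by apply/tens_classP/tens_scaleDl_class.
Qed.

Fact tens_scale1 : left_id 1 tens_scale.
Proof.
elim/tens_ind => s; rewrite tens_scaleE; congr tens_class.
by rewrite -[RHS]map_id; apply: eq_map => -[c m]; rewrite mul1r.
Qed.

Fact tens_addN : left_inverse tens_zero tens_opp tens_add.
Proof.
move=> x; rewrite /tens_opp -[X in tens_add _ X]tens_scale1 -tens_scaleDl addNr.
by elim/tens_ind: x => s; rewrite tens_scaleE; apply/tens_classP/tens_scale_class0.
Qed.

HB.instance Definition _ :=
  GRing.isZmodule.Build tensor tens_addA tens_addC tens_add0 tens_addN.

Fact tens_scaleA a b (x : tensor) : tens_scale a (tens_scale b x) = tens_scale (a * b) x.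
Proof.
elim/tens_ind: x => s; rewrite !tens_scaleE -map_comp; congr tens_class.
by apply: eq_map => p /=; rewrite mulrA.
Qed.

Fact tens_scaleDr : right_distributive tens_scale +%R.
Proof.
move=> a; do 2![elim/tens_ind => ?].
by rewrite [_ + _]tens_addE !tens_scaleE [RHS]tens_addE map_cat.
Qed.

HB.instance Definition _ :=
  GRing.Zmodule_isLmodule.Build S tensor tens_scaleA tens_scale1 tens_scaleDr
    tens_scaleDl.

Definition pure_tensor (a : S) (m : M) : tensor := tens_class [:: (a, m)].

Lemma tensor_universal (P : zmodType) (beta : S -> M -> P) :
  (forall a b m, beta (a + b) m = beta a m + beta b m) ->
  (forall a m n, beta a (m + n) = beta a m + beta a n) ->
  (forall a r m, beta (a * f r) m = beta a (r *: m)) ->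
  exists! g : tensor -> P, zmod_morphism g /\
    (forall a m, g (pure_tensor a m) = beta a m).
Proof.
move=> bDl bDr bbal; pose ev s := \sum_(p <- s) beta p.1 p.2.
have b0 m : beta 0 m = 0 by apply: (addrI (beta 0 m)); rewrite -bDl !addr0.
have evE s t : tens_eq s t -> ev s = ev t.
  rewrite /ev; elim=> // {s t}.
  - by move=> s t u _ -> _ ->.
  - by move=> s s' t t' _ e1 _ e2; rewrite !big_cat /= e1 e2.
  - by move=> s t; rewrite !big_cat /= addrC.
  - by move=> m; rewrite big_seq1 big_nil b0.
  - by move=> a b m; rewrite !big_cons !big_nil !addr0 bDl.
  - by move=> a m n; rewrite !big_cons !big_nil !addr0 bDr.
  - by move=> a r m; rewrite !big_seq1 bbal.
pose g (x : tensor) := ev (repr x).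
have gE s : g (tens_class s) = ev s by apply/evE/repr_tens_class.
have gD x y : g (x + y) = g x + g y.
  elim/tens_ind: x => s; elim/tens_ind: y => t.
  by rewrite [_ + _]tens_addE !gE /ev big_cat.
exists g; split.
  split=> [x y|a m]; last by rewrite gE /ev big_seq1.
  by apply: (addIr (g y)); rewrite -gD !subrK.
move=> h [hB hE]; apply: funext; elim/tens_ind.
have h0 : h 0 = 0 by have := hB 0 0; rewrite !subrr.
have hD x y : h (x + y) = h x + h y.
  by rewrite -[y in LHS]opprK hB -[- y]sub0r hB h0 sub0r opprK.
elim=> [|[a m] s IHs]; first by rewrite gE /ev big_nil; apply/esym; exact: h0.
rewrite -cat1s -tens_addE [LHS]gD [RHS]hD IHs; congr (_ + _).
by rewrite gE /ev big_seq1 [RHS]hE.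
Qed.

End Tensor.

Section Orders.
Variables (o : idomainType) (A : falgType {fraction o}).

(* X is an o-order in the subalgebra B of A, whose unit algid B may differ     *)
(* from 1: a subring of B that is finitely generated as an o-module and that   *)
(* spans B over the field of fractions.                                        *)
Definition is_order (B : {aspace A}) (X : set A) : Prop :=
  [/\ X (algid B), forall x y, X x -> X y -> X (x - y),
      forall x y, X x -> X y -> X (x * y) &
      exists (n : nat) (s : n.-tuple A),
        (forall x, X x <-> exists c : 'I_n -> o, x = \sum_i tofrac (c i) *: s`_i)
        /\ <<s>>%VS = B].

Definition is_maximal_order (B : {aspace A}) (X : set A) : Prop :=
  is_order B X /\ (forall Y, is_order B Y -> X `<=` Y -> Y `<=` X).

(* X, with the operations of A, is isomorphic to a matrix ring over a          *)
(* commutative ring.                                                           *)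
Definition is_comm_matrix_ring (X : set A) : Prop :=
  exists (R : comNzRingType) (a : nat) (phi : {additive 'M[R]_a.+1 -> A}),
    [/\ forall u v, phi (u *m v) = phi u * phi v, injective phi &
        range phi = X].

(* X is the internal direct sum of the rings G j.  If each G j has a unit,     *)
(* orthogonality makes the sum direct.                                         *)
Definition is_ring_direct_sum (X : set A) (k : nat) (G : 'I_k -> set A) : Prop :=
  (forall x, X x <-> exists y : 'I_k -> A, (forall j, G j (y j)) /\ x = \sum_j y j)
  /\ (forall i j, i != j -> forall x y, G i x -> G j y -> x * y = 0).

Definition is_nice (X : set A) : Prop :=
  exists (k : nat) (G : 'I_k -> set A), is_ring_direct_sum X G /\
    forall j, (exists B, is_maximal_order B (G j)) \/ is_comm_matrix_ring (G j).

Definition Fitting_order (S : subringClosed A) : Prop :=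
  separable_algebra A /\ is_order {:A}%AS [set` S].

Definition central_conductor (T S : subringClosed A) : set A :=
  [set x | centre T x /\ forall y, y \in T -> x * y \in S].

End Orders.

Section FittingInvariants.
Variables (F : fieldType) (A : falgType F) (S : subringClosed A).

Definition is_GL (b : nat) (H : 'M[subring S]_b) : Prop :=
  exists H' : 'M[subring S]_b, H *m H' = 1%:M /\ H' *m H = 1%:M.

Definition nrS (b : nat) (H : 'M[subring S]_b) : A := nr (map_mx val H).

Definition calU : set A :=
  ring_span (centre S)
    [set z | exists (b : nat) (H : 'M[subring S]_b), is_GL H /\ z = nrS H].

Definition Fit (a b : nat) (h : 'M[subring S]_(a, b)) : set A :=
  if (b <= a)%N then
    ring_span calU
      [set z | exists f : 'I_b -> 'I_a,
         {homo f : i j / (i < j)%N} /\ z = nrS (rowsub f h)]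
  else [set 0].

Variable M : lmodType (subring S).

Definition finitely_generated : Prop :=
  exists (n : nat) (s : 'I_n -> M),
    forall m, exists c : 'I_n -> subring S, m = \sum_i c i *: s i.

Definition presents (a b : nat) (h : 'M[subring S]_(a, b)) : Prop :=
  exists p : {linear 'rV[subring S]_b -> M},
    (forall m, exists v, p v = m) /\
    (forall v, p v = 0 <-> exists w : 'rV_a, v = w *m h).

Definition Fitting_invariant (X : set A) : Prop :=
  exists (a b : nat) (h : 'M[subring S]_(a, b)), presents h /\ X = Fit h.

Definition maximal_Fitting_invariant (X : set A) : Prop :=
  Fitting_invariant X /\
  (forall Y, Fitting_invariant Y -> X `<=` Y -> Y = X).

(* The maximal Fitting invariant exists and is unique for a finitely generated *)
(* module over a Fitting order; the default value set0 is never used then.     *)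
Definition Fitmax : set A :=
  xget set0 [set X | maximal_Fitting_invariant X /\
                     forall Y, maximal_Fitting_invariant Y -> Y = X].

Definition central_annihilator : set A :=
  [set x | exists y : subring S,
     [/\ x = val y, centre S x & forall m : M, y *: m = 0]].

End FittingInvariants.

(* Main.v *)
Require Import Defs.
From HB Require Import structures.
From mathcomp Require Import all_boot all_order all_algebra all_field.
From mathcomp Require Import perm boolp classical_sets.

Import GRing.Theory.
Local Open Scope classical_set_scope.
Local Open Scope ring_scope.

(* The key point is that every square matrix H over a nice order Gamma has a   *)
(* matrix K over Gamma with K H = nr(H) central in Gamma.  On a component      *)
(* M_a(R), R commutative, nr(H) is the determinant over R and K the adjugate.  *)
(* On a maximal order, look at a simple component with a splitting rho: if     *)
(* nr(H) <> 0 then K := nr(H) H^-1 is mapped by rho to the adjugate of rho(H), *)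
(* a polynomial in rho(H) whose coefficients, being coefficients of the        *)
(* characteristic polynomial, are integral over o; as rho is injective and o   *)
(* is noetherian, adjoining such elements to Gamma gives an order again, so    *)
(* they already lie in Gamma by maximality.                                    *)
(* Hence Fitting invariants over Gamma lie in the centre of Gamma and          *)
(* annihilate Gamma (x) M; for x in the conductor, g (x) m |-> (x g) m carries *)
(* this annihilation to M.  For the first inclusion, two presentations of a    *)
(* module are refined by a third one whose invariant contains both, so, Gamma  *)
(* being noetherian over o, there is a greatest invariant over Gamma; it       *)
(* contains Fit(1 (x) h) >= Fit(h) for each presentation h of M.  The reduced  *)
(* norm is only ever used through its defining property, and its default value *)
(* 0 is harmless: its existence need not be established.                       *)

(** * Central idempotents of semisimple algebras *)

(** The proof transports the commutative adjugate argument. From K H = nr(H) ([nrS_adjugate]), any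
    module whose relations include the rows of H is killed by nr(H); the same identity keeps the
    span U(Gamma) inside the centre of Gamma ([calU_nice]). This gives the second inclusion through
    [Fit_annihilates] and [conductor_annihilates]. The first is monotonicity: reduced norms and U
    grow from Lambda to Gamma ([Fit_incl]), extending scalars in a presentation of M presents the
    tensor product ([tensor_presentation]), and over Gamma the maximal invariant contains all the
    others ([Fitmax_greatest]).

    The adjugates are assembled in [nice_adjugate] from [matrix_ring_adjugate] and
    [maximal_order_adjugate]. Both compare with a splitting of each simple component: splittings
    exist by density ([splitting_exists]), are faithful on their component ([splitting_inj]), and
    [central_idempotent_ind] glues the components. In the maximal case the determinant trick
    ([blockrep_eigen], [charpoly_integral]) supplies integrality, which [maximal_order_absorbs]
    turns into membership. *)

Lemma vspace_of_pred {F : fieldType} {V : vectType F} (P : set V) :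
  P 0 -> (forall x y, P x -> P y -> P (x + y)) ->
  (forall c x, P x -> P (c *: x)) ->
  exists U : {vspace V}, forall x, x \in U <-> P x.
Proof.
move=> P0 PD PZ.
pose sub (U : {vspace V}) := forall x, x \in U -> P x.
pose Q d := `[< exists U, sub U /\ \dim U = d >].
have exQ : exists d, Q d.
  exists 0%N; apply/asboolP; exists 0%VS.
  by split; [move=> x; rewrite memv0 => /eqP-> | rewrite dimv0].
have leQ d : Q d -> (d <= \dim {:V})%N.
  by move=> /asboolP[U [_ <-]]; apply/dimvS/subvf.
case: (ex_maxnP exQ leQ) => d /asboolP[U [subU dU]] dmax.
exists U => x; split=> [/subU//|Px].
(* [U] has maximal dimension among the subspaces contained in [P], and adding the line through [x]
   stays inside [P]. *)
have /eqP -> : U == (U + <[x]>)%VS; last by rewrite memvE addvSr.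
rewrite eqEdim addvSl /= dU; apply: dmax; apply/asboolP; exists (U + <[x]>)%VS.
split=> // y /memv_addP[u /subU Pu [w /vlineP[c ->] ->]].
by apply: PD => //; apply: PZ.
Qed.

Section Semisimple.
Context {F : fieldType} {A : falgType F}.
Implicit Types (x y u v e f : A).

Lemma memZP x : reflect (forall y, x * y = y * x) (x \in 'Z({:A})%VS).
Proof.
rewrite memv_cap memvf /=; apply: (iffP centvP) => h y; first by apply: h; rewrite memvf.
by rewrite h.
Qed.

(** Split 1 = u + v along the left ideal and a complement. For x in the ideal, x v = x - x u lies in
    both summands, hence vanishes. *)
Lemma left_ideal_idempotent (P : set A) : semisimple_algebra A ->
  P 0 -> (forall x y, P x -> P y -> P (x + y)) ->
  (forall a x, P x -> P (a * x)) ->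
  exists u, P u /\ forall x, P x -> x * u = x.
Proof.
move=> ss P0 PD PM.
have PZ c x : P x -> P (c *: x) by rewrite -mulr_algl => /PM.
have [U UP] := vspace_of_pred P P0 PD PZ.
have [|V [AV UV UV0]] := ss U.
  by apply/prodvP=> a x _ /UP Px; apply/UP/PM.
have : 1 \in (U + V)%VS by rewrite UV memvf.
case/memv_addP=> u Uu [v Vv e1]; exists u; split=> [|x Px]; first exact/UP.
have xv : x * v = x - x * u by rewrite -[X in X - _]mulr1 e1 mulrDr addrAC subrr add0r.
have : x * v \in (U :&: V)%VS.
  rewrite memv_cap; apply/andP; split.
    by rewrite xv rpredB //; apply/UP => //; apply: PM; apply/UP.
  by apply: (subvP AV); rewrite memv_mul ?memvf.
by rewrite UV0 memv0 xv subr_eq0 => /eqP.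
Qed.

(** Induction on the dimension of A u: if u is not primitive, a proper central idempotent f below it
    splits u into f and u - f, each generating a smaller ideal. Applied to u = 1, this reduces a
    claim about A to its simple components. *)
Lemma central_idempotent_ind (P : A -> Prop) :
  P 0 -> (forall e, primitive_central_idempotent e -> P e) ->
  (forall u v, central_idempotent u -> central_idempotent v -> u * v = 0 ->
     P u -> P v -> P (u + v)) ->
  forall u, central_idempotent u -> P u.
Proof.
move=> P0 Pprim PD u.
have [n] := ubnP (\dim ({:A} * <[u]>)).
elim: n u => // n IH u; rewrite ltnS => dn cu.
have [->//|/eqP u0] := eqVneq u 0.
have [pu|npu] := pselect (primitive_central_idempotent u); first exact: Pprim.
have [f [[fZ ff] fu [f0 nfu]]] :
    exists f, [/\ central_idempotent f, f * u = f & f <> 0 /\ f <> u].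
  apply: contrapT => nex; apply: npu; split=> // f cf fu.
  by apply: contrapT => /not_orP nf; apply: nex; exists f.
have [uZ uu] := cu.
have uf : u * f = f by rewrite (memZP _ uZ).
have dimlt g : g * u = g -> g * g = g -> g <> u ->
    (\dim ({:A} * <[g]>) < \dim ({:A} * <[u]>))%N.
  move=> gu gg ngu.
  have sgu : ({:A} * <[g]> <= {:A} * <[u]>)%VS.
    apply/subvP=> x /memv_cosetP[a _ ->]; rewrite -gu mulrA.
    by rewrite memv_mul ?memvf ?memv_line.
  rewrite ltnNge; apply/negP => le; apply: ngu.
  have : u \in ({:A} * <[g]>)%VS.
    have /eqP -> : ({:A} * <[g]> == {:A} * <[u]>)%VS by rewrite eqEdim sgu.
    by rewrite -[X in X \in _]uu memv_mul ?memvf ?memv_line.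
  case/memv_cosetP=> a _ ua.
  have ug : u * g = u by rewrite ua -mulrA gg.
  by rewrite -ug -{1}[g in LHS]gu (memZP _ uZ) gu.
have cv : central_idempotent (u - f).
  split; first by rewrite rpredB.
  by rewrite mulrBl !mulrBr uu uf fu ff subrr subr0.
rewrite -[u](subrK f) addrC; apply: PD => //.
- by rewrite mulrBr fu ff subrr.
- by apply: IH => //; apply: leq_trans dn; apply: dimlt.
- apply: IH => //; apply: leq_trans dn; apply: dimlt.
  + by rewrite mulrBl uu fu.
  + by case: cv.
  + by move=> /(canRL (subrK _)) /eqP; rewrite -subr_eq0 opprD addNKr oppr_eq0 => /eqP.
Qed.

Lemma central_idempotentM f g : central_idempotent f -> central_idempotent g ->
  central_idempotent (f * g).
Proof.
move=> [fZ ff] [gZ gg]; split.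
  by apply/memZP=> y; rewrite -mulrA (memZP _ gZ) mulrA (memZP _ fZ) mulrA.
by rewrite -mulrA (mulrA g) -(memZP _ fZ) -mulrA gg mulrA ff.
Qed.

Lemma primitive_le e f : primitive_central_idempotent e -> central_idempotent f ->
  f * e = 0 \/ f * e = e.
Proof.
move=> [ce e0 emin] cf; apply: emin; first exact: central_idempotentM.
by rewrite -mulrA (proj2 ce).
Qed.

(* A two-sided ideal [P] is generated as a left ideal by an idempotent [u];    *)
(* [u A (1 - u) = 0], and [(1 - u) A u] is a left ideal of square zero, so it  *)
(* vanishes too.                                                               *)
Lemma ideal_central_idempotent (P : set A) : semisimple_algebra A ->
  P 0 -> (forall x y, P x -> P y -> P (x + y)) ->
  (forall a x, P x -> P (a * x)) -> (forall a x, P x -> P (x * a)) ->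
  exists u, [/\ P u, central_idempotent u & forall x, P x -> x * u = x].
Proof.
move=> ss P0 PD PMl PMr.
have [u [Pu uP]] := left_ideal_idempotent P ss P0 PD PMl.
have uu : u * u = u by apply: uP.
have uau a : u * a * u = u * a by apply/uP/PMr.
exists u; split=> //; split=> //; apply/memZP=> y.
pose N : set A := [set x | exists a, x = (1 - u) * a * u].
have [w [[a wa] wP]] : exists w, N w /\ forall x, N x -> x * w = x.
  apply: left_ideal_idempotent => //.
  - by exists 0; rewrite mulr0 mul0r.
  - by move=> _ _ [a ->] [b ->]; exists (a + b); rewrite mulrDr mulrDl.
  - move=> b _ [a ->]; exists (b * (1 - u) * a).
    have z : u * (b * (1 - u) * a) * u = 0.
      by rewrite uau mulrBr mulr1 mulrA mulrBr mulrA uau subrr mul0r.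
    set t := b * (1 - u) * a in z *.
    by rewrite [in RHS]mulrBl mul1r [in RHS]mulrBl z subr0 /t !mulrA.
have w0 : w = 0.
  have : w * w = w by apply: wP; exists a.
  rewrite {1 2}wa !mulrA -(mulrA _ u) mulrBr mulr1 uu subrr mulr0 !mul0r.
  by move=> <-.
have : (1 - u) * y * u = 0 by rewrite -(wP ((1 - u) * y * u)) ?w0 ?mulr0 //; exists y.
by rewrite !mulrBl mul1r uau => /eqP; rewrite subr_eq0 => /eqP.
Qed.

End Semisimple.

(** * Splittings of simple components *)

Section Density.
Context {L : fieldType} {n : nat} (E : set 'M[L]_n).
Hypotheses (E1 : E 1%:M) (ED : forall X Y, E X -> E Y -> E (X + Y))
  (EM : forall X Y, E X -> E Y -> E (X *m Y)) (EZ : forall c X, E X -> E (c *: X)).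
Hypothesis E_irr : forall u v : 'cV_n, u != 0 -> exists2 X, E X & X *m u = v.
Hypothesis E_comm :
  forall T, (forall X, E X -> T *m X = X *m T) -> exists c, T = c%:M.

Let EN X : E X -> E (- X). Proof. by rewrite -scaleN1r; apply: EZ. Qed.
Let EB X Y : E X -> E Y -> E (X - Y). Proof. by move=> EX /EN; apply: ED. Qed.
Let E0 : E 0. Proof. by rewrite -(scale0r 1%:M); apply: EZ. Qed.
Let Esum (I : Type) (r : seq I) (P : pred I) X :
  (forall i, P i -> E (X i)) -> E (\sum_(i <- r | P i) X i).
Proof. by move=> EX; elim/big_ind: _ => //; apply: ED. Qed.

Let u (i : 'I_n) : 'cV[L]_n := delta_mx i 0.
Let u0 i : u i != 0.
Proof.
by apply/eqP=> /matrixP/(_ i 0); rewrite !mxE !eqxx => /eqP; rewrite oner_eq0.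
Qed.
Let usum (v : 'cV_n) : v = \sum_i v i 0 *: u i.
Proof.
rewrite {1}(matrix_sum_delta v); apply: eq_bigr => i _.
by rewrite big_ord_recl big_ord0 addr0.
Qed.
Let eq_on_u (X Y : 'M_n) : (forall i, X *m u i = Y *m u i) -> X = Y.
Proof.
by move=> XY; apply/matrixP=> i j; have /matrixP/(_ i 0) := XY j; rewrite -!colE !mxE.
Qed.

Let separated (k : nat) := forall j : 'I_n, (j < k)%N -> exists2 X, E X &
  forall i : 'I_n, (i < k)%N -> X *m u i = if i == j then u i else 0.

(** Suppose every element of [E] killing the u_i with i < k also kills u_k. Then Z u_i |-> Z X_i u_k
    is well defined for each i < k, where X_i is the given projection to u_i. It commutes with [E],
    so it is a scalar and X_i u_k is a multiple of u_i. Since 1 - sum X_i kills all these u_i, it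
    kills u_k, which makes u_k a combination of the earlier basis vectors. *)
Let separating (k : 'I_n) : separated k ->
  exists X, [/\ E X, forall i : 'I_n, (i < k)%N -> X *m u i = 0 & X *m u k != 0].
Proof.
move=> sep; apply: contrapT => nex.
have kill X : E X -> (forall i : 'I_n, (i < k)%N -> X *m u i = 0) -> X *m u k = 0.
  by move=> EX X0; apply/eqP/negPn/negP=> nz; apply: nex; exists X.
have {}sep (j : 'I_n) : exists X, E X /\ ((j < k)%N ->
    forall i : 'I_n, (i < k)%N -> X *m u i = if i == j then u i else 0).
  case: (ltnP j k) => [/sep[X EX hX]|_]; first by exists X.
  by exists 0.
have {sep} [X XP] := choice sep.
have EX i : E (X i) by case: (XP i).
have eigen (i : 'I_n) : (i < k)%N -> exists c, X i *m u k = c *: u i.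
  move=> ik; have Xi := (proj2 (XP i)) ik.
  have : forall l, exists Y, E Y /\ Y *m u i = u l.
    by move=> l; have [Y EY hY] := E_irr _ (u l) (u0 i); exists Y.
  case/choice=> Y YP.
  have XiY Z : E Z -> Z *m u i = 0 -> Z *m X i *m u k = 0.
    move=> EZ' Zi; apply: kill => [|l lk]; first exact: EM.
    by rewrite -mulmxA Xi //; case: eqP => [->|]; rewrite ?mulmx0.
  pose T := \matrix_(a, l) (Y l *m X i *m u k) a 0.
  have Tu l : T *m u l = Y l *m X i *m u k.
    by rewrite -colE; apply/colP=> a; rewrite !mxE.
  have TZ Z : E Z -> T *m (Z *m u i) = Z *m X i *m u k.
    move=> hZ; apply/eqP; rewrite eq_sym -subr_eq0; apply/eqP.
    pose W := Z - \sum_l (Z *m u i) l 0 *: Y l.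
    have W0 : W *m u i = 0.
      rewrite mulmxBl [X in X - _](usum (Z *m u i)) mulmx_suml -sumrB big1 // => l _.
      by rewrite -scalemxAl (proj2 (YP l)) subrr.
    have EW : E W by apply: EB => //; apply: Esum => l _; apply/EZ; case: (YP l).
    rewrite -(XiY _ EW W0) (usum (Z *m u i)) mulmx_sumr /W !mulmxBl !mulmx_suml.
    by congr (_ - _); apply: eq_bigr => l _; rewrite -scalemxAr -!scalemxAl Tu.
  have [c Tc] : exists c, T = c%:M.
    apply: E_comm => Z hZ; apply: eq_on_u => l; rewrite -!mulmxA.
    have [EY Yl] := YP l.
    by rewrite -Yl (mulmxA Z) !TZ ?mulmxA //; apply: EM.
  exists c; have := TZ _ E1; rewrite !mul1mx Tc mul_scalar_mx; exact: esym.
have : (1%:M - \sum_(i < n | (i < k)%N) X i) *m u k = 0.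
  apply: kill => [|i ik]; first by apply: EB => //; apply: Esum.
  rewrite mulmxBl mul1mx mulmx_suml (bigD1 i) //= (proj2 (XP i)) // eqxx big1 ?addr0 ?subrr //.
  by move=> j /andP[jk ji]; rewrite (proj2 (XP j)) // eq_sym (negPf ji).
move/matrixP/(_ k 0); rewrite mulmxBl mul1mx mulmx_suml !mxE !eqxx summxE big1.
  by rewrite subr0 => /eqP; rewrite oner_eq0.
move=> i ik; have [c ->] := eigen i ik; rewrite !mxE eq_sym.
by rewrite (_ : i == k = false) ?mulr0 //; apply/negbTE; rewrite neq_ltn ik.
Qed.

(** The operator V Z kills the earlier vectors and fixes u_k. It is the new projection, and
    subtracting W V Z corrects the old ones at u_k. *)
Let all_separated k : (k <= n)%N -> separated k.
Proof.
elim: k => [|k IH] kn j //; pose kk : 'I_n := Ordinal kn.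
have sep := IH (ltnW kn).
have [Z [hZ Z0 Zk]] := separating kk sep.
have [V hV VZ] := E_irr _ (u kk) Zk; rewrite mulmxA in VZ.
have VZ0 (i : 'I_n) : (i < k)%N -> V *m Z *m u i = 0.
  by move=> ik; rewrite -mulmxA Z0 ?mulmx0.
have kE (i : 'I_n) : (i < k.+1)%N -> ~ (i < k)%N -> i = kk.
  move=> i1 i2; apply/val_inj => /=; apply/eqP; rewrite eqn_leq -ltnS i1 /=.
  by rewrite leqNgt; apply/negP.
move=> jk; have [jk'|njk] := pselect (j < k)%N.
  have [X hX XP] := sep j jk'.
  have [W hW WP] := E_irr _ (X *m u kk) (u0 kk).
  exists (X - W *m (V *m Z)); first by apply: EB => //; do 2!apply: EM => //.
  move=> i ik; rewrite mulmxBl -mulmxA; have [ik'|nik] := pselect (i < k)%N.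
    by rewrite VZ0 // mulmx0 subr0 XP.
  rewrite (kE i ik nik) VZ WP subrr; case: eqP => // kj.
  by move: jk'; rewrite -kj ltnn.
exists (V *m Z); first exact: EM.
move=> i ik; rewrite (kE j jk njk); have [ik'|nik] := pselect (i < k)%N.
  by rewrite VZ0 //; case: eqP => // ikk; move: ik'; rewrite ikk ltnn.
by rewrite (kE i ik nik) eqxx.
Qed.

(** A matrix unit is the projection to u_j followed by an element of [E] moving u_j to u_i. *)
Lemma jacobson_density X : E X.
Proof.
rewrite (matrix_sum_delta X); apply: Esum => i _; apply: Esum => j _; apply: EZ.
have [Z hZ ZP] := all_separated _ (leqnn n) j (ltn_ord j).
have [Y hY YP] := E_irr _ (u i) (u0 j).
suff -> : delta_mx i j = Y *m Z by apply: EM.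
apply: eq_on_u => l; rewrite -mulmxA ZP // mul_delta_mx_cond.
by case: (eqVneq l j) => [->|_]; rewrite ?YP ?mulmx0.
Qed.

End Density.

(** The inclusion [j] is only additive and multiplicative: it sends 1 to [algid C], which may differ
    from the unit of [A]. *)
Lemma aspace_field {F : fieldType} {A : falgType F} (C : {aspace A}) :
  {in C &, commutative *%R} ->
  (forall x, x \in C -> x != 0 -> exists2 y, y \in C & y * x = algid C) ->
  exists (L : fieldType) (j : L -> A),
    [/\ (forall x y, j (x + y) = j x + j y) /\ (forall x y, j (x * y) = j x * j y),
        j 1 = algid C, forall c, j c \in C &
        forall a, a \in C -> exists c, j c = a].
Proof.
move=> mulC invC.
have cC : @commutative (subvs_of C) _ *%R by move=> x y; apply/val_inj/mulC; apply: subvsP.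
pose comM := GRing.PzRing_hasCommutativeMul.Build (subvs_of C) cC.
pose L1 : comUnitRingType := HB.pack (subvs_of C) comM.
have fL : GRing.field_axiom L1.
  move=> x x0; apply/unitrP.
  have [|y Cy yx] := invC (vsval x) (subvsP x).
    by apply: contra x0 => /eqP vx; apply/eqP/val_inj.
  exists (Subvs Cy : L1).
  have yx1 : (Subvs Cy : L1) * x = 1 by apply: val_inj.
  by split=> //; rewrite mulrC.
pose L2 : fieldType := HB.pack (GRing.ComUnitRing.sort L1) (GRing.ComUnitRing_isField.Build L1 fL).
exists L2, (fun x : L1 => vsval x); split=> //.
- by move=> c; apply: subvsP.
- by move=> a Ca; exists (Subvs Ca).
Qed.

Section Splitting.
Context {F : fieldType} {A : falgType F}.
Hypothesis ss : semisimple_algebra A.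
Implicit Types (x y u v e f : A).

(** Take f in A e with A f of least dimension. For nonzero x in A f, the left ideal A x is generated
    by an idempotent g; minimality gives A g = A f, so f lies in A x. *)
Lemma minimal_idempotent e : e <> 0 -> central_idempotent e ->
  exists f, [/\ f != 0, f * f = f, f * e = f &
    forall x, x * f = x -> x != 0 -> exists a, a * x = f].
Proof.
move=> e0 [eZ ee].
pose Q (d : nat) := `[< exists f, [/\ f != 0, f * f = f, f * e = f & \dim ({:A} * <[f]>) = d] >].
have exQ : exists d, Q d.
  by exists (\dim ({:A} * <[e]>)); apply/asboolP; exists e; split=> //; apply/eqP.
case: (ex_minnP exQ) => d /asboolP[f [f0 ff fe df]] dmin.
exists f; split=> // x xf x0.
have [g [[a ga] gP]] :
    exists g, (exists a, g = a * x) /\ forall y, (exists a, y = a * x) -> y * g = y.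
  apply: (left_ideal_idempotent (fun y => exists a, y = a * x)) => //.
  - by exists 0; rewrite mul0r.
  - by move=> _ _ [a ->] [b ->]; exists (a + b); rewrite mulrDl.
  - by move=> b _ [a ->]; exists (b * a); rewrite mulrA.
have gf : g * f = g by rewrite ga -mulrA xf.
have xg : x * g = x by apply: gP; exists 1; rewrite mul1r.
have sgf : ({:A} * <[g]> <= {:A} * <[f]>)%VS.
  apply/subvP=> y /memv_cosetP[b _ ->]; rewrite -gf mulrA.
  by rewrite memv_mul ?memvf ?memv_line.
have : f \in ({:A} * <[g]>)%VS.
  have /eqP -> : ({:A} * <[g]> == {:A} * <[f]>)%VS.
    rewrite eqEdim sgf df; apply: dmin; apply/asboolP; exists g; split=> //.
    - by apply: contraNneq x0 => g0; rewrite -xg g0 mulr0.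
    - by apply: gP; exists a.
    - by rewrite -gf -mulrA fe.
  by rewrite -[X in X \in _]ff memv_mul ?memvf ?memv_line.
by case/memv_cosetP=> b _ ->; exists (b * a); rewrite ga mulrA.
Qed.

(** [C] is a space of pairwise commuting elements of f A f of maximal dimension, so anything in f A
    f commuting with it can be adjoined without enlarging it. Closure under products is not imposed;
    it follows from this maximality. *)
Lemma maximal_commutative f : f * f = f ->
  exists C : {vspace A}, [/\ f \in C, forall c, c \in C -> f * c = c /\ c * f = c,
    {in C &, commutative *%R} &
    forall d : A, f * d = d -> d * f = d -> (forall c, c \in C -> d * c = c * d) -> d \in C].
Proof.
move=> ff.
pose good (C : {vspace A}) := [/\ f \in C, forall c, c \in C -> f * c = c /\ c * f = c &
  {in C &, commutative *%R}].
pose Q (d : nat) := `[< exists C, good C /\ \dim C = d >].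
have exQ : exists d, Q d.
  exists (\dim <[f]>); apply/asboolP; exists <[f]>%VS; split=> //; split.
  - exact: memv_line.
  - by move=> _ /vlineP[c ->]; rewrite -scalerAl -scalerAr ff.
  - move=> _ _ /vlineP[c ->] /vlineP[c' ->].
    by rewrite -!scalerAl -!scalerAr scalerA mulrC -scalerA.
have leQ (d : nat) : Q d -> (d <= \dim {:A})%N.
  by move=> /asboolP[U [_ <-]]; apply/dimvS/subvf.
case: (ex_maxnP exQ leQ) => m /asboolP[C [[fC fid comC] dC]] dmax.
exists C; split=> // d fd df dc.
have /eqP -> : C == (C + <[d]>)%VS; last by rewrite memvE addvSr.
rewrite eqEdim addvSl /= dC; apply: dmax; apply/asboolP; exists (C + <[d]>)%VS.
split=> //; split.
- by rewrite (subvP (addvSl _ _)).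
- move=> _ /memv_addP[c /fid[fc cf] [_ /vlineP[k ->] ->]].
  by rewrite mulrDl mulrDr -scalerAl -scalerAr fc cf fd df.
- move=> _ _ /memv_addP[c cC [_ /vlineP[k ->] ->]] /memv_addP[c' cC' [_ /vlineP[k' ->] ->]].
  rewrite !mulrDl !mulrDr -!scalerAl -!scalerAr (comC c c') // (dc c) // (dc c') //.
  by rewrite -!addrA; congr (_ + _); rewrite !scalerA (mulrC k') addrCA.
Qed.

(* The field [L] is a maximal commutative subalgebra of the division algebra   *)
(* [f A f], where [A f] is a minimal left ideal contained in [A e].            *)
Lemma splitting_data e : e <> 0 -> central_idempotent e ->
  exists (L : fieldType) (j : L -> A) (f : A),
  [/\ f != 0 /\ f * e = f,
      (forall x y : L, j (x + y) = j x + j y) /\ (forall x y : L, j (x * y) = j x * j y),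
      j 1 = f /\ (forall k : F, exists c, j c = k *: f),
      forall x, x * f = x -> x != 0 -> exists a, a * x = f &
      (forall c, f * j c = j c) /\ forall d : A, f * d = d -> d * f = d ->
        (forall c, d * j c = j c * d) -> exists c, j c = d].
Proof.
move=> e0 ce.
have [f [f0 ff fe fmin]] := minimal_idempotent e e0 ce.
have [C [fC Cf comC maxC]] := maximal_commutative f ff.
have CC : is_aspace C.
  apply/andP; split.
    by apply/has_algidP; exists f; split=> // c /Cf[].
  apply/prodvP=> x y xC yC; have [fx xf] := Cf x xC; have [fy yf] := Cf y yC.
  apply: maxC => [||c cC]; rewrite ?mulrA ?fx -?mulrA ?yf //.
  by rewrite (comC y c) // mulrA (comC x c) // mulrA.
pose CA : {aspace A} := ASpace CC.
have algC : algid CA = f.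
  by rewrite -[LHS](proj1 (Cf _ (memv_algid CA))) algidr.
have [||L [j [[jD jM] j1 jC jsurj]]] := @aspace_field _ _ CA.
- exact: comC.
- move=> x xC x0; have [fx xf] := Cf x xC; rewrite algC.
  have [a ax] := fmin x xf x0.
  pose d := f * a * f.
  have dx : d * x = f by rewrite /d -mulrA fx -mulrA ax.
  have fd : f * d = d by rewrite /d !mulrA ff.
  have df : d * f = d by rewrite /d -!mulrA ff.
  have d0 : d != 0 by apply: contraNneq f0 => d0; rewrite -dx d0 mul0r.
  have [b bd] := fmin d df d0.
  (* The left inverse d has itself a left inverse b, and b d = f forces x = f b f; so d is a
     two-sided inverse of x in f A f. *)
  have xd : x * d = f.
    have xE : x = f * b * f.
      by rewrite -[X in _ = _ * X]dx -mulrA (mulrA b) bd !fx.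
    by rewrite xE -!mulrA fd bd ff.
  exists d => //; apply: maxC => // c cC; have [fc cf] := Cf c cC.
  by rewrite -[c in LHS]cf -{1}xd !mulrA -(mulrA d c x) (comC c x) // mulrA dx fc.
- exists L, j, f; split=> //.
  + split; first by rewrite j1 algC.
    by move=> k; apply: jsurj; rewrite memvZ.
  + split=> [c|d fd df dc]; first by case: (Cf _ (jC c)).
    by apply/jsurj/maxC => // c cC; have [c' <-] := jsurj c cC; apply: dc.
Qed.
End Splitting.

Section Splitting.
Context {F : fieldType} {A : falgType F}.
Hypothesis ss : semisimple_algebra A.
Implicit Types (x y e f : A).

(** Represent A by left multiplication on the minimal left ideal A f, a right vector space over L.
    Minimality of A f makes the action irreducible and maximality of L makes its commutant scalar,
    so density shows that the image spans all matrices over L. *)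
Lemma splitting_exists e : primitive_central_idempotent e ->
  exists (L : fieldType) (n : nat) (rho : {rmorphism A -> 'M[L]_n.+1}), is_splitting e rho.
Proof.
move=> [ce e0 _].
have [L [j [f [[f0 fe] [jD jM] [j1 jF] fmin [fj jmax]]]]] := splitting_data ss e e0 ce.
have ff : f * f = f by rewrite -j1 -jM mulr1.
have jf c : j c * f = j c by rewrite -j1 -jM mulr1.
have j0 : j 0 = 0 by apply: (addrI (j 0)); rewrite -jD !addr0.
have jN c : j (- c) = - j c by apply: (addrI (j c)); rewrite -jD !subrr j0.
pose w n (v : 'I_n -> A) (c : 'cV[L]_n) := \sum_i v i * j (c i 0).
pose gen n (v : 'I_n -> A) := (forall i, v i * f = v i) /\
   forall x, x * f = x -> exists c, x = w n v c.
have exQ : exists n, `[< exists v, gen n v >].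
  exists (\dim {:A}); apply/asboolP; exists (fun i => (vbasis {:A})`_i * f); split.
    by move=> i; rewrite -mulrA ff.
  move=> x xf; have /choice[c cP] :
      forall i : 'I_(\dim {:A}), exists c, j c = coord (vbasis {:A}) i x *: f.
    by move=> i; apply: jF.
  exists (\col_i c i); rewrite -[LHS]xf {1}(coord_vbasis (memvf x)) mulr_suml.
  by apply: eq_bigr => i _; rewrite mxE cP -scalerAl -scalerAr -mulrA ff.
case: (ex_minnP exQ) => n0 /asboolP[v0 [v0f v0gen]] nmin.
have n0E : n0 = n0.-1.+1.
  case: n0 v0 v0f v0gen {nmin} => // v0 _ v0gen.
  have [c fc] := v0gen f ff; move: f0; rewrite fc /w big_ord0 eqxx //.
move: n0E v0 v0f v0gen nmin; move: n0.-1 => n -> v vf vgen nmin {n0}.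
have wD c c' : w _ v (c + c') = w _ v c + w _ v c'.
  by rewrite -big_split; apply: eq_bigr => i _ /=; rewrite mxE jD mulrDr.
have wZ a c : w _ v (a *: c) = w _ v c * j a.
  by rewrite mulr_suml; apply: eq_bigr => i _; rewrite mxE mulrC jM mulrA.
have wf c : w _ v c * f = w _ v c.
  by rewrite mulr_suml; apply: eq_bigr => i _; rewrite -mulrA jf.
(* The generating family [v] has least length, so it is a basis: a nontrivial relation would express
   one v_k through the others. *)
have w0 c : w _ v c = 0 -> c = 0.
  move=> wc; apply/colP=> k; rewrite mxE; apply/eqP/negPn/negP=> ck.
  have vk : v k = \sum_i v (lift k i) * j (- (c (lift k i) 0 / c k 0)).
    have : w _ v ((c k 0)^-1 *: c) = 0 by rewrite wZ wc mul0r.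
    rewrite /w (bigD1_ord k) //= mxE mulVf // j1 vf => /eqP; rewrite addr_eq0 => /eqP ->.
    by rewrite -sumrN; apply: eq_bigr => i _; rewrite mxE jN mulrN mulrC.
  suff : (n.+1 <= n)%N by rewrite ltnn.
  apply: nmin; apply/asboolP; exists (fun i => v (lift k i)); split=> // x xf.
  have [d ->] := vgen x xf.
  exists (\col_i (d (lift k i) 0 - c (lift k i) 0 / c k 0 * d k 0)).
  rewrite /w (bigD1_ord k) //= {1}vk mulr_suml -big_split; apply: eq_bigr => i _ /=.
  by rewrite mxE jD mulrDr addrC -!mulNr (jM _ (d k 0)) mulrA.
have winj c c' : w _ v c = w _ v c' -> c = c'.
  move=> cc'; apply/eqP; rewrite -subr_eq0; apply/eqP/w0.
  by rewrite wD -scaleN1r wZ -cc' jN j1 mulrN wf subrr.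
have /choice[cl colP'] : forall ak : A * 'I_n.+1, exists c, ak.1 * v ak.2 = w _ v c.
  by move=> [a k] /=; apply: vgen; rewrite -mulrA vf.
pose rho (a : A) : 'M[L]_n.+1 := \matrix_(i, k) cl (a, k) i 0.
have wsum (I : finType) (c : I -> 'cV[L]_n.+1) : w _ v (\sum_i c i) = \sum_i w _ v (c i).
  by apply: (big_morph _ wD); apply: big1 => i _; rewrite mxE j0 mulr0.
have rhoP a c : w _ v (rho a *m c) = a * w _ v c.
  have cE : c = \sum_i c i 0 *: delta_mx i 0.
    rewrite {1}(matrix_sum_delta c); apply: eq_bigr => i _.
    by rewrite big_ord_recl big_ord0 addr0.
  rewrite {1}cE mulmx_sumr wsum mulr_sumr; apply: eq_bigr => k _.
  rewrite -scalemxAr wZ mulrA (colP' (a, k)); congr (w _ v _ * _).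
  by rewrite -colE; apply/colP=> i; rewrite !mxE.
have rhoE a (X : 'M_n.+1) : (forall c, w _ v (X *m c) = a * w _ v c) -> rho a = X.
  move=> XP; apply/matrixP=> i k; have : col k (rho a) = col k X.
    by rewrite !colE; apply: winj; rewrite rhoP XP.
  by move/(congr1 (fun M : 'cV_n.+1 => M i 0)); rewrite !mxE.
have rhoB : zmod_morphism rho.
  by move=> a b; apply: rhoE => c;
    rewrite mulmxBl wD -scaleN1r wZ !rhoP jN j1 mulrN -mulrA wf -mulrBl.
have rhoM : monoid_morphism rho.
  by split=> [|a b]; apply: rhoE => c; rewrite ?mul1mx ?mul1r // -mulmxA !rhoP mulrA.
pose rhom : {rmorphism A -> 'M[L]_n.+1} := HB.pack rho
  (GRing.isZmodMorphism.Build A 'M[L]_n.+1 rho rhoB)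
  (GRing.isMonoidMorphism.Build A 'M[L]_n.+1 rho rhoM).
exists L, n, rhom; split.
  have [eZ ee] := ce; apply: rhoE => c; rewrite mul1mx (memZP _ eZ).
  by rewrite -[in RHS]wf -mulrA fe wf.
pose E : set 'M[L]_n.+1 := [set X | exists (r : nat) (c : 'I_r -> L) (x : 'I_r -> A),
  X = \sum_i c i *: rhom (x i)].
have Erho a : E (rho a).
  by exists 1%N, (fun=> 1), (fun=> a); rewrite big_ord_recl big_ord0 addr0 scale1r.
have ED X Y : E X -> E Y -> E (X + Y).
  move=> [r [c [x ->]]] [r' [c' [x' ->]]]; exists (r + r')%N.
  exists (fun i => match split i with inl k => c k | inr k => c' k end).
  exists (fun i => match split i with inl k => x k | inr k => x' k end).
  rewrite big_split_ord; congr (_ + _); apply: eq_bigr => i _.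
    by rewrite (unsplitK (inl i)).
  by rewrite (unsplitK (inr i)).
have EZ a X : E X -> E (a *: X).
  move=> [r [c [x ->]]]; exists r, (fun i => a * c i), x.
  by rewrite scaler_sumr; apply: eq_bigr => i _; rewrite scalerA.
suff : forall X, E X by [].
apply: jacobson_density => //.
- by have <- : rho 1 = 1%:M := rhoM.1.
- move=> _ _ [r [c [x ->]]] [r' [c' [x' ->]]]; rewrite mulmx_suml; elim/big_ind: _ => //.
    by rewrite -(scale0r (rho 1)); apply: EZ.
  move=> i _; rewrite -scalemxAl mulmx_sumr; apply: EZ.
  exists r', c', (fun k => x i * x' k); apply: eq_bigr => k _.
  by rewrite -scalemxAr rmorphM.
- move=> c d c0; have [||a ac] := fmin (w _ v c).
  + exact: wf.
  + by apply: contraNneq c0 => /w0->.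
  exists (rho (w _ v d * a)) => //.
  by apply: winj; rewrite rhoP -mulrA ac wf.
(* An endomorphism commuting with A is right multiplication by the image d of f. As it is also
   L-linear, d commutes with L, hence belongs to L. *)
- move=> T TP; have [cf fE] := vgen f ff.
  pose d := w _ v (T *m cf).
  have TE x : x * f = x -> exists c, x = w _ v c /\ w _ v (T *m c) = x * d.
    move=> xf; have [c xc] := vgen x xf; exists c; split=> //.
    have -> : c = rho x *m cf by apply: winj; rewrite rhoP -fE xf.
    by rewrite mulmxA TP // -mulmxA rhoP.
  have TE' c : w _ v (T *m c) = w _ v c * d.
    by have [c' [/winj <- ->]] := TE _ (wf c).
  have [|||lam lamP] := jmax d.
  + by rewrite {1}fE -TE'.
  + exact: wf.
  + move=> c; rewrite -wZ scalemxAr TE'; congr (_ * _).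
    by rewrite wZ -fE fj.
  exists lam; apply/matrixP=> i k; have : col k T = col k lam%:M.
    by rewrite !colE; apply: winj; rewrite TE' mul_scalar_mx wZ lamP.
  by move/(congr1 (fun M : 'cV_n.+1 => M i 0)); rewrite !mxE.
Qed.
End Splitting.

Lemma cent_all_scalar {R : pzRingType} {n : nat} (X : 'M[R]_n.+1) :
  (forall i j, X *m delta_mx i j = delta_mx i j *m X) -> X = (X 0 0)%:M.
Proof.
move=> XC; apply/matrixP=> i j; have /matrixP/(_ i 0) := XC j 0.
rewrite !mxE (bigD1 j) //= big1 => [|k kj]; last by rewrite mxE (negPf kj) mulr0.
rewrite mxE !eqxx mulr1 addr0 => ->.
rewrite (bigD1 0) //= big1 => [|k k0]; last by rewrite mxE (negPf k0) andbF mul0r.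
by rewrite mxE eqxx andbT addr0 mulr_natl.
Qed.

Lemma scalar_rmorphism {R : pzRingType} {L : nzRingType} {n : nat}
    (g : {rmorphism R -> 'M[L]_n.+1}) :
  (forall r, exists c, g r = c%:M) ->
  exists s : {rmorphism R -> L}, forall r, g r = (s r)%:M.
Proof.
move=> gs; pose s r := g r 0 0.
have gE r : g r = (s r)%:M.
  by have [c gc] := gs r; rewrite /s gc !mxE.
have sB : zmod_morphism s by move=> x y; rewrite /s rmorphB !mxE.
have sM : monoid_morphism s.
  split=> [|x y]; rewrite /s ?rmorph1 ?mxE //.
  by rewrite rmorphM (gE x) (gE y) -[_ * _]scalar_mxM !mxE.
pose sm : {rmorphism R -> L} := HB.pack s
  (GRing.isZmodMorphism.Build R L s sB) (GRing.isMonoidMorphism.Build R L s sM).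
by exists sm.
Qed.

Section SplittingTheory.
Context {F : fieldType} {A : falgType F} {e : A} {L : fieldType} {n : nat}
  (rho : {rmorphism A -> 'M[L]_n.+1}).
Hypotheses (pe : primitive_central_idempotent e) (sp : is_splitting e rho).

Lemma splitting_central x : x \in 'Z({:A})%VS -> exists c, rho x = c%:M.
Proof.
move=> xZ; exists (rho x 0 0); apply: cent_all_scalar => i j.
have [r [c [y ->]]] := proj2 sp (delta_mx i j).
rewrite mulmx_sumr mulmx_suml; apply: eq_bigr => k _.
by rewrite -scalemxAr -scalemxAl -![_ *m _]rmorphM (memZP _ xZ).
Qed.

Lemma splitting_base :
  exists iota : {rmorphism F -> L}, forall c x, rho (c *: x) = iota c *: rho x.
Proof.
have [c|iota iotaP] := scalar_rmorphism (rho \o in_alg A).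
  apply: splitting_central; apply/memZP=> y.
  by rewrite -scalerAl -scalerAr mul1r mulr1.
exists iota => c x; rewrite -mulr_algl rmorphM /=.
by rewrite -mul_scalar_mx -iotaP.
Qed.

(** The kernel of [rho] inside A e is a two-sided ideal, so it is generated by a central idempotent
    u below e. Primitivity leaves u = 0 or u = e, and the latter is excluded by rho(e) = 1. *)
Lemma splitting_inj : semisimple_algebra A -> forall x, rho x = 0 -> x * e = 0.
Proof.
move=> ss; have [ce e0 emin] := pe; have [eZ ee] := ce.
have [u [[ru ue] cu uP]] : exists u, [/\ rho u = 0 /\ u * e = u, central_idempotent u &
   forall x, rho x = 0 /\ x * e = x -> x * u = x].
  apply: (ideal_central_idempotent (fun x => rho x = 0 /\ x * e = x)) => //.
  - by rewrite rmorph0 mul0r.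
  - by move=> x y [rx xe] [ry ye]; rewrite rmorphD rx ry addr0 mulrDl xe ye.
  - by move=> a x [rx xe]; rewrite rmorphM rx mulr0 -mulrA xe.
  - by move=> a x [rx xe]; rewrite rmorphM rx mul0r -mulrA -(memZP _ eZ) mulrA xe.
move=> x rx; have xu : x * e * u = x * e.
  by apply: uP; rewrite rmorphM rx mul0r -mulrA ee.
have [u0|ue'] := emin u cu ue; first by rewrite -xu u0 mulr0.
by have := oner_neq0 'M[L]_n.+1; rewrite -(proj1 sp) -ue' ru eqxx.
Qed.

End SplittingTheory.

(** * Block matrices under a splitting, and determinants of block-triangular matrices *)

Section BlockRepresentation.
Context {A : nzRingType} {L : comNzRingType} {n : nat} (rho : {rmorphism A -> 'M[L]_n.+1}).

Definition blockrep {a b : nat} (H : 'M[A]_(a, b)) := \mxblock_(i < a, j < b) rho (H i j).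

Lemma blockrepM {a b c} (H : 'M[A]_(a, b)) (K : 'M_(b, c)) :
  blockrep (H *m K) = blockrep H *m blockrep K.
Proof.
rewrite mul_mxblock; apply/eq_mxblockP => i j; rewrite mxE rmorph_sum.
by apply: eq_bigr => k _; rewrite rmorphM.
Qed.

Lemma blockrep_scalar {b} (z : A) c : rho z = c%:M -> blockrep (z%:M : 'M_b) = c%:M.
Proof.
move=> zc; rewrite -mxdiagZ; apply/eq_mxblockP => i j; rewrite mxE.
by case: eqVneq => _; rewrite ?mulr1n ?mulr0n ?rmorph0 // conform_mx_id.
Qed.

Lemma blockrep0 {a b} : blockrep (0 : 'M[A]_(a, b)) = 0.
Proof. by rewrite -mxblock0; apply/eq_mxblockP => i j; rewrite mxE rmorph0. Qed.

Lemma blockrep_inj {a b} (H K : 'M[A]_(a, b)) :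
  blockrep H = blockrep K -> forall i j, rho (H i j) = rho (K i j).
Proof.
move=> HK i j; rewrite -(mxblockK (fun i j => rho (H i j))).
by rewrite -[X in submxblock X]/(blockrep H) HK mxblockK.
Qed.

End BlockRepresentation.

Lemma det_mxsub_bij {R : comPzRingType} {m n : nat} (g : 'I_m -> 'I_n) (X : 'M[R]_n) :
  bijective g -> \det (mxsub g g X) = \det X.
Proof.
move=> gb; have mn : m = n by rewrite -(card_ord m) -(card_ord n); apply: bij_eq_card gb.
case: n / mn in g gb X *; pose s := perm (bij_inj gb).
have -> : mxsub g g X = row_perm s (col_perm s X).
  by apply/matrixP=> i j; rewrite !mxE !permE.
by rewrite row_permE col_permE !det_mulmx !det_perm ?odd_permV mulrCA -expr2 sqrr_sign mulr1.
Qed.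

Section ExtendByIdentity.
Context {A : nzRingType} {L : fieldType} {n : nat} (rho : {rmorphism A -> 'M[L]_n.+1}).

(** The blown-up index set of a matrix of size b1 + b2 and the sum of those of its two parts agree
    only through a bijection; [enc] is that bijection, and determinants are carried along it. *)
Let enc b1 b2 (k : 'I_(\sum_(i < b1) n.+1 + \sum_(i < b2) n.+1)) : 'I_(\sum_(i < b1 + b2) n.+1) :=
  match split k with
  | inl k1 => @tagnat.Rank (b1 + b2) (fun=> n.+1) (lshift b2 (tagnat.sig1 k1)) (tagnat.sig2 k1)
  | inr k2 => @tagnat.Rank (b1 + b2) (fun=> n.+1) (rshift b1 (tagnat.sig1 k2)) (tagnat.sig2 k2)
  end.

Let sig_inj b (k l : 'I_(\sum_(i < b) n.+1)) : tagnat.sig1 k = tagnat.sig1 l ->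
  tagnat.sig2 k = tagnat.sig2 l :> nat -> k = l.
Proof.
by move=> e1 e2; apply: val_inj; rewrite /= [LHS]tagnat.rect [RHS]tagnat.rect e1 e2.
Qed.

Let enc_inj b1 b2 : injective (@enc b1 b2).
Proof.
move=> k l; rewrite -[k]splitK -[l]splitK /enc !unsplitK.
case: (split k) (split l) => {}k [] {}l /(congr1 val)/eqP;
  rewrite tagnat.eq_Rank => /andP[/eqP/(congr1 val)/= i12 /eqP j12].
- by congr (unsplit (inl _)); apply: sig_inj => //; apply: val_inj.
- by have := ltn_ord (tagnat.sig1 k); rewrite i12 ltnNge leq_addr.
- by have := ltn_ord (tagnat.sig1 l); rewrite -i12 ltnNge leq_addr.
- by congr (unsplit (inr _)); apply: sig_inj => //; apply/val_inj/addnI/i12.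
Qed.

Let enc_bij b1 b2 : bijective (@enc b1 b2).
Proof.
apply: inj_card_bij; first exact: enc_inj.
by rewrite !card_ord big_split_ord.
Qed.

Let sig2_Rank b (i : 'I_b) (k : 'I_n.+1) :
  (tagnat.sig2 (@tagnat.Rank b (fun=> n.+1) i k) : 'I_n.+1) = k.
Proof. by rewrite tagnat.Rank2K; apply: val_inj. Qed.

Let blockrep_split b1 b2 (X : 'M[A]_b1) Y Z (W : 'M[A]_b2) :
  mxsub (@enc b1 b2) (@enc b1 b2) (blockrep rho (block_mx X Y Z W)) =
  block_mx (blockrep rho X) (blockrep rho Y) (blockrep rho Z) (blockrep rho W).
Proof.
have bE (a b : nat) (H : 'M[A]_(a, b)) k l : blockrep rho H k l =
    rho (H (tagnat.sig1 k) (tagnat.sig1 l)) (tagnat.sig2 k) (tagnat.sig2 l) by rewrite mxE.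
apply/matrixP=> k l; rewrite -[k]splitK -[l]splitK [LHS]mxE bE /enc !unsplitK.
case: (split k) (split l) => {}k [] {}l;
  rewrite ?block_mxEul ?block_mxEur ?block_mxEdl ?block_mxEdr bE !tagnat.Rank1K;
  rewrite ?block_mxEul ?block_mxEur ?block_mxEdl ?block_mxEdr;
  by congr (rho _ _ _); apply: sig2_Rank.
Qed.

(** Adding generators together with relations that eliminate them extends a relation matrix in this
    triangular way, leaving the reduced norm unchanged. *)
Lemma det_blockrep_lblock {b1 b2} (X : 'M[A]_b1) (Z : 'M_(b2, b1)) :
  \det (blockrep rho (block_mx X 0 Z 1%:M)) = \det (blockrep rho X).
Proof.
rewrite -(det_mxsub_bij _ _ (enc_bij b1 b2)) blockrep_split.
by rewrite blockrep0 det_lblock (blockrep_scalar rho _ _ (rmorph1 rho)) det1 mulr1.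
Qed.

Lemma det_blockrep_rblock {b1 b2} (Y : 'M_(b1, b2)) (X : 'M[A]_b2) :
  \det (blockrep rho (block_mx 1%:M Y 0 X)) = \det (blockrep rho X).
Proof.
rewrite -(det_mxsub_bij _ _ (enc_bij b1 b2)) blockrep_split.
by rewrite blockrep0 det_ublock (blockrep_scalar rho _ _ (rmorph1 rho)) det1 mul1r.
Qed.
End ExtendByIdentity.

(** * Finitely generated modules and integrality *)

Section Span.
Context {o : nzRingType} {K : nzRingType} (i : {rmorphism o -> K}) {V : lmodType K}.

(** The o-module structure is the one induced by [i] from the K-module [V], so that one space can be
    viewed over o through different coefficient fields. *)
Definition ospan {J : finType} (g : J -> V) : set V :=
  [set x | exists c : J -> o, x = \sum_j i (c j) *: g j].

Definition osubmodule (W : set V) : Prop :=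
  [/\ W 0, forall x y, W x -> W y -> W (x + y) & forall c x, W x -> W (i c *: x)].

Lemma osubmodule_sum W (I : Type) (r : seq I) (P : pred I) (x : I -> V) :
  osubmodule W -> (forall k, P k -> W (x k)) -> W (\sum_(k <- r | P k) x k).
Proof. by case=> W0 WD _ Wx; elim/big_ind: _. Qed.

Lemma ospan_submodule {J : finType} (g : J -> V) : osubmodule (ospan g).
Proof.
split.
- by exists (fun=> 0); rewrite big1 // => j _; rewrite rmorph0 scale0r.
- move=> _ _ [c ->] [d ->]; exists (fun j => c j + d j).
  by rewrite -big_split; apply: eq_bigr => j _; rewrite rmorphD scalerDl.
- move=> a _ [c ->]; exists (fun j => a * c j).
  by rewrite scaler_sumr; apply: eq_bigr => j _; rewrite rmorphM scalerA.
Qed.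

Lemma ospan_gen {J : finType} (g : J -> V) j : ospan g (g j).
Proof.
exists (fun k => (k == j)%:R); rewrite (bigD1 j) //= eqxx rmorph1 scale1r big1 ?addr0 //.
by move=> k /negPf->; rewrite rmorph0 scale0r.
Qed.

Lemma ospan_sub {J : finType} (g : J -> V) W :
  osubmodule W -> (forall j, W (g j)) -> ospan g `<=` W.
Proof.
move=> sW Wg _ [c ->]; apply: osubmodule_sum => // j _.
by case: sW => _ _; apply.
Qed.

End Span.

(** Induction on the length: the first coordinates of [W] form a finitely generated ideal. After
    subtracting a combination of lifts of its generators, only vectors with first coordinate 0
    remain. *)
Lemma noetherian_rV {o : idomainType} : noetherian o ->
  forall m (W : set 'rV[o]_m), osubmodule idfun W ->
  exists (r : nat) (w : 'I_r -> 'rV_m),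
    (forall k, W (w k)) /\ W `<=` ospan idfun w.
Proof.
move=> noeth; elim=> [|m IH] W sW.
  by exists 0%N, (fun=> 0); split=> [[]//|v _]; exists (fun=> 0); rewrite big_ord0 [v]thinmx0.
have [W0 WD WZ] := sW.
pose I : set o := [set x | exists2 v, W v & v 0 0 = x].
have [s Is] : exists s : seq o, I = ring_span setT [set` s].
  apply: noeth; split.
  - by exists 0; rewrite ?mxE.
  - by move=> _ _ [v Wv <-] [v' Wv' <-]; exists (v + v'); rewrite ?mxE //; apply: WD.
  - by move=> a _ [v Wv <-]; exists (a *: v); rewrite ?mxE //; apply: WZ.
have /choice[u uP] : forall k : 'I_(size s), exists v, W v /\ v 0 0 = s`_k.
  move=> k; suff [v Wv v0] : I s`_k by exists v.
  rewrite Is; exists 1%N, (fun=> 1), (fun=> s`_k); split=> [_|].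
    by split=> //; apply: mem_nth.
  by rewrite big_ord_recl big_ord0 mul1r addr0.
pose z (x : 'rV[o]_m) : 'rV[o]_m.+1 := row_mx (0 : 'rV_1) x.
have zD x y : z (x + y) = z x + z y.
  by apply/rowP=> k; rewrite !mxE; case: splitP => k' _; rewrite !mxE ?addr0.
have zZ c x : z (c *: x) = c *: z x.
  by apply/rowP=> k; rewrite !mxE; case: splitP => k' _; rewrite !mxE ?mulr0.
have z0 : z 0 = 0 by rewrite -(scale0r 0) zZ scale0r.
pose W' : set 'rV[o]_m := [set v' | W (z v')].
have [|r [w' [Ww' w'P]]] := IH W'.
  split; rewrite /W' /=.
  - by rewrite z0.
  - by move=> x y Wx Wy; rewrite zD; apply: WD.
  - by move=> c x Wx; rewrite zZ; apply: WZ.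
pose w (k : 'I_(size s + r)) : 'rV_m.+1 :=
  match split k with inl k1 => u k1 | inr k2 => z (w' k2) end.
exists (size s + r)%N, w; split=> [k|v Wv].
  by rewrite /w; case: (split k) => k'; [case: (uP k') | apply: Ww'].
have sw := ospan_submodule idfun w; have [_ wD wZ] := sw.
have wu k : ospan idfun w (u k).
  by have := ospan_gen idfun w (unsplit (inl k)); rewrite {2}/w unsplitK.
have ww' k : ospan idfun w (z (w' k)).
  by have := ospan_gen idfun w (unsplit (inr k)); rewrite {2}/w unsplitK.
have : I (v 0 0) by exists v.
rewrite Is => -[n [c [g [gs v0]]]].
have /choice[q qP] : forall k, exists q : 'I_(size s), s`_q = g k.
  by move=> k; have [_ /(nthP 0)[q qs <-]] := gs k; exists (Ordinal qs).
pose t := \sum_k c k *: u (q k).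
have Wt : W t by apply: (osubmodule_sum idfun) => // k _; apply: WZ; case: (uP (q k)).
have wt : ospan idfun w t by apply: (osubmodule_sum idfun) => // k _; apply: wZ.
have vt0 : (v - t) 0 0 = 0.
  rewrite !mxE v0 summxE; apply/eqP; rewrite subr_eq0; apply/eqP.
  by apply: eq_bigr => k _; rewrite mxE (proj2 (uP _)) qP.
have Wvt : W (v - t) by apply: WD => //; rewrite -scaleN1r; apply: WZ.
have zE : v - t = z (rsubmx (v - t : 'rV_(1 + m))).
  apply/rowP=> k; rewrite [RHS]mxE; case: splitP => k' kk'; rewrite [RHS]mxE.
    by rewrite -[RHS]vt0; congr ((v - t) _ _); apply: val_inj; rewrite /= kk' ord1.
  by congr ((v - t) _ _); apply: val_inj.
have [|d dE] := w'P (rsubmx (v - t : 'rV_(1 + m))).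
  by rewrite /W' /= -zE.
rewrite -(subrK t v); apply: wD => //; rewrite zE dE.
by rewrite (big_morph z zD z0); apply: (osubmodule_sum idfun) => // j _; rewrite zZ; apply: wZ.
Qed.

(** [W] embeds in a finitely generated module; the coordinate vectors that represent its image form
    a submodule of a free module, and their generators lift back. *)
Lemma fg_of_injection {o : idomainType} {K K' : nzRingType}
    (i : {rmorphism o -> K}) (i' : {rmorphism o -> K'}) {V : lmodType K} {V' : lmodType K'}
    (f : {additive V -> V'}) (W : set V) {J : finType} (g : J -> V') :
  noetherian o -> osubmodule i W -> (forall c x, f (i c *: x) = i' c *: f x) ->
  (forall x, W x -> f x = 0 -> x = 0) -> (forall x, W x -> ospan i' g (f x)) ->
  exists (r : nat) (w : 'I_r -> V), (forall k, W (w k)) /\ W `<=` ospan i w.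
Proof.
move=> noeth sW fZ finj fg; have [W0 WD WZ] := sW.
pose ev (v : 'rV[o]_#|J|) := \sum_j i' (v 0 (enum_rank j)) *: g j.
have evD v v' : ev (v + v') = ev v + ev v'.
  by rewrite -big_split; apply: eq_bigr => j _; rewrite mxE rmorphD scalerDl.
have evZ c v : ev (c *: v) = i' c *: ev v.
  by rewrite scaler_sumr; apply: eq_bigr => j _; rewrite mxE rmorphM scalerA.
have ev0 : ev 0 = 0 by rewrite -(scale0r 0) evZ rmorph0 scale0r.
have [|r [v [vW vgen]]] := noetherian_rV noeth _ [set v | exists2 x, W x & f x = ev v].
  split.
  - by exists 0; rewrite ?raddf0 ?ev0.
  - by move=> v v' [x Wx fx] [x' Wx' fx']; exists (x + x'); [apply: WD | rewrite raddfD evD fx fx'].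
  - by move=> c v [x Wx fx]; exists (i c *: x); [apply: WZ | rewrite fZ evZ fx].
have /choice[w wP] : forall k, exists x, W x /\ f x = ev (v k).
  by move=> k; have [x Wx fx] := vW k; exists x.
exists r, w; split=> [k|x Wx]; first by case: (wP k).
have [c fx] := fg x Wx.
have [|d dE] := vgen (\row_k c (enum_val k)).
  by exists x => //; rewrite fx; apply: eq_bigr => j _; rewrite mxE enum_rankK.
exists d; apply/eqP; rewrite -subr_eq0; apply/eqP; apply: finj.
  apply: WD => //; rewrite -scaleN1r -[-1](rmorphN1 i); apply: (WZ).
  by apply: (osubmodule_sum i) => // k _; apply: WZ; case: (wP k).
rewrite raddfB raddf_sum; apply/eqP; rewrite subr_eq0; apply/eqP.
have -> : f x = ev (\row_k c (enum_val k)).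
  by rewrite fx; apply: eq_bigr => j _; rewrite mxE enum_rankK.
rewrite dE (big_morph ev evD ev0); apply: eq_bigr => k _.
by rewrite fZ evZ (proj2 (wP k)).
Qed.

(** * Integral elements and coefficients of characteristic polynomials *)

Lemma irreducible_factor {L : fieldType} (p : {poly L}) : (1 < size p)%N ->
  exists2 q, irreducible_poly q & q %| p.
Proof.
move=> p1; have p0 : p != 0 by rewrite -size_poly_gt0 (ltn_trans _ p1).
pose Q n := `[< exists q : {poly L}, [/\ (1 < size q)%N, q %| p & size q = n] >].
have exQ : exists n, Q n by exists (size p); apply/asboolP; exists p; rewrite dvdpp.
case: (ex_minnP exQ) => n /asboolP[q [q1 qp sq]] nmin; exists q => //; split=> // d d1 dq.
have dp := dvdp_trans dq qp.
have d0 : d != 0 by apply: contraTneq dp => ->; rewrite dvd0p.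
rewrite -(dvdp_size_eqp dq) eqn_leq dvdp_leq //=; last first.
  by rewrite -size_poly_gt0 (ltn_trans _ q1).
rewrite sq; apply: nmin; apply/asboolP; exists d; split=> //.
by rewrite ltn_neqAle eq_sym d1 size_poly_gt0.
Qed.

Lemma poly_splits {L : fieldType} (p : {poly L}) : p \is monic ->
  exists (L' : fieldType) (t : {rmorphism L -> L'}) (rs : seq L'),
    map_poly t p = \prod_(r <- rs) ('X - r%:P).
Proof.
have [n] := ubnP (size p); elim: n L p => // n IH L p; rewrite ltnS => pn mp.
have [p1|p1] := leqP (size p) 1.
  move: mp; rewrite {1}(size1_polyC p1) monicE lead_coefC => /eqP c1.
  exists L, (idfun : {rmorphism L -> L}), [::].
  by rewrite (size1_polyC p1) c1 rmorph1 big_nil.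
have [q iq qp] := irreducible_factor p p1.
have [L1 _ [z qz _]] := irredp_FAdjoin iq.
have : root (map_poly (in_alg L1) p) z.
  by case/dvdpP: qp => s ->; rewrite rmorphM rootM qz orbT.
case/factor_theorem=> p' pE.
have mp' : p' \is monic by rewrite -(monicMr _ (monicXsubC z)) -pE map_monic.
have sp : size p = (size p').+1.
  by rewrite -(size_map_poly (in_alg L1)) pE size_Mmonic ?monicXsubC ?monic_neq0 //
    size_XsubC addn2.
have [|L2 [t [rs tp]]] := IH L1 p' _ mp'; first by rewrite -ltnS -sp.
exists L2, (t \o in_alg L1), (t z :: rs).
by rewrite map_poly_comp pE rmorphM /= tp big_cons mulrC map_polyXsubC.
Qed.

(** The determinant trick: lam is a root of the characteristic polynomial of a matrix over o. That
    matrix is the transpose of [Q], because eigenvectors are row vectors. *)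
Lemma integral_eigen {o : comNzRingType} {L : fieldType} (i : {rmorphism o -> L})
    {J : finType} (y : J -> L) (Q : J -> J -> o) (lam : L) :
  (exists j, y j != 0) -> (forall j, lam * y j = \sum_k i (Q j k) * y k) ->
  integralOver i lam.
Proof.
move=> [j0 y0] yQ.
pose M : 'M[o]_#|J| := \matrix_(k, j) Q (enum_val j) (enum_val k).
exists (char_poly M); first exact: char_poly_monic.
rewrite map_char_poly -eigenvalue_root_char; apply/eigenvalueP.
exists (\row_k y (enum_val k)).
  apply/rowP=> j; rewrite !mxE yQ [RHS](reindex _ (onW_bij _ (@enum_val_bij J))) /=.
  by apply: eq_bigr => k _; rewrite !mxE mulrC.
apply: contraNneq y0 => /rowP/(_ (enum_rank j0)).
by rewrite !mxE enum_rankK => ->.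
Qed.

Lemma integralOver_fmorph {o : comNzRingType} {L L' : fieldType} (i : {rmorphism o -> L})
  (t : {rmorphism L -> L'}) c : integralOver (t \o i) (t c) -> integralOver i c.
Proof. by case=> p mp; rewrite map_poly_comp fmorph_root; exists p. Qed.

(** Over a splitting field the coefficients are polynomials in the eigenvalues, and integrality
    descends along field embeddings. The hypothesis ranges over all extensions since the eigenvalues
    need not lie in [L]. *)
Lemma charpoly_integral {o : comNzRingType} {L : fieldType} (i : {rmorphism o -> L})
    {m : nat} (S : 'M[L]_m) :
  (forall (L' : fieldType) (t : {rmorphism L -> L'}) lam (v : 'rV_m),
     v != 0 -> v *m map_mx t S = lam *: v -> integralOver (t \o i) lam) ->
  forall k, integralOver i (char_poly S)`_k.
Proof.
move=> eigS k; have [L' [t [rs tS]]] := poly_splits _ (char_poly_monic S).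
apply: (integralOver_fmorph i t); rewrite -coef_map /= tS.
have : forall r, r \in rs -> integralOver (t \o i) r.
  move=> r rrs; have : eigenvalue (map_mx t S) r.
    by rewrite eigenvalue_root_char -map_char_poly tS root_prod_XsubC.
  by case/eigenvalueP=> v vS v0; apply: (eigS L' t r v).
move=> {tS} rs_int; elim: rs rs_int k => [|r rs IH] rs_int k.
  by rewrite big_nil coef1; apply: integral_nat.
have {}IH k' : integralOver (t \o i) (\prod_(r <- rs) ('X - r%:P))`_k'.
  by apply: IH => r' r'rs; apply: rs_int; rewrite inE r'rs orbT.
rewrite big_cons mulrBl coefB mulrC coefMX coefCM; apply: integral_sub.
  by case: ifP => _ //; apply: integral0.
by apply: integral_mul => //; apply: rs_int; rewrite mem_head.
Qed.

(** Integral elements are adjoined one at a time: the monic relation of c rewrites high powers, so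
    products of the old generators with powers of c below the degree suffice. *)
Lemma integral_fg {o : comNzRingType} {L : comNzRingType} (i : {rmorphism o -> L}) (cs : seq L) :
  (forall c, c \in cs -> integralOver i c) ->
  exists (J : finType) (g : J -> L^o),
    [/\ ospan i g 1, forall c, c \in cs -> ospan i g c &
        forall x y, ospan i g x -> ospan i g y -> ospan i g (x * y)].
Proof.
elim: cs => [|c cs IH] csint.
  exists 'I_1, (fun=> 1); split=> //; first exact: (ospan_gen i (fun=> 1) ord0).
  move=> _ _ [a ->] [b ->]; exists (fun k => a k * b k).
  by rewrite !big_ord1 /GRing.scale /= !mulr1 rmorphM.
have [|J [g [S1 Scs SM]]] := IH; first by move=> c' c'cs; apply: csint; rewrite inE c'cs orbT.
have [p mp pc] := csint c (mem_head _ _).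
have [d sp] : exists d, size p = d.+1.
  by exists (size p).-1; rewrite prednK // size_poly_gt0 monic_neq0.
have cd : c ^+ d = - \sum_(k < d) i p`_k * c ^+ k.
  apply/eqP; rewrite -addr_eq0 addrC; move/eqP: pc.
  rewrite (@horner_coef_wide _ d.+1) -?sp ?size_poly // sp big_ord_recr /= !coef_map /=.
  have -> : p`_d = 1 by have := monicP mp; rewrite lead_coefE sp.
  rewrite rmorph1 mul1r => pc0; apply/eqP; apply: etrans pc0; congr (_ + _).
  by apply: eq_bigr => k _; rewrite coef_map.
pose g' (jk : J * 'I_d) : L^o := g jk.1 * c ^+ jk.2.
have sS' := ospan_submodule i g'; have [S'0 S'D S'Z] := sS'.
have SS' n x : ospan i g x -> ospan i g' (x * c ^+ n).
  elim/ltn_ind: n x => n IHn x Sx; have [nd|dn] := ltnP n d.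
    case: Sx => a ->; rewrite mulr_suml; apply: (osubmodule_sum i) => // j _.
    rewrite -[_ * _ ^+ _]mulrA; apply: S'Z; exact: (ospan_gen i g' (j, Ordinal nd)).
  rewrite -(subnK dn) exprD cd mulrN mulr_sumr -sumrN mulr_sumr.
  apply: (osubmodule_sum i) => // k _.
  have -> : x * - (c ^+ (n - d) * (i p`_k * c ^+ k)) = i (- p`_k) * (x * c ^+ (n - d + k)).
    by rewrite rmorphN mulNr mulrN exprD; congr (- _); rewrite !(mulrCA (i _)).
  apply: S'Z; apply: IHn => //.
  by rewrite -[ltnRHS](subnK dn) ltn_add2l.
exists (J * 'I_d)%type, g'; split.
- by rewrite -[1]mulr1 -(expr0 c); apply: SS'.
- move=> c'; rewrite inE => /predU1P[->|/Scs Sc'].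
    by rewrite -[c]mul1r -[X in _ * X]expr1; apply: SS'.
  by rewrite -[c']mulr1 -(expr0 c); apply: SS'.
- move=> _ _ [a ->] [b ->]; rewrite mulr_suml; apply: (osubmodule_sum i) => // jk _.
  rewrite mulr_sumr; apply: (osubmodule_sum i) => // lm _.
  have -> : (i (a jk) *: g' jk : L) * (i (b lm) *: g' lm) =
     i (a jk * b lm) * (g jk.1 * g lm.1 * c ^+ (jk.2 + lm.2)).
    rewrite /GRing.scale /= /g' rmorphM exprD -!mulrA; congr (_ * _).
    by rewrite !(mulrCA _ (i _)); congr (_ * _); congr (_ * _); rewrite mulrCA.
  by apply: S'Z; apply: SS'; apply: SM; apply: ospan_gen.
Qed.

(** * Maximal orders *)

Section Eigen.
Context {o : comNzRingType} {F : fieldType} {A : falgType F} {L : fieldType} {n m b : nat}.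
Context (tof : {rmorphism o -> F}) (i : {rmorphism o -> L}) (r : {rmorphism A -> 'M[L]_n.+1}).

(** For the blocks V_j of the eigenvector, lam V_j r(s_k) = sum_l V_l r(H_lj s_k), and H_lj s_k is
    an o-combination of the s_p. Hence a fixed coordinate of all V_j r(s_k) satisfies the
    determinant trick; some coordinate is nonzero because 1 is a combination of the r(s_k). *)
Lemma blockrep_eigen (s : 'I_m -> A) (H : 'M[A]_b) lam (v : 'rV_(\sum_(j < b) n.+1)) :
  (forall c x, r (tof c *: x) = i c *: r x) ->
  (forall j l k, ospan tof s (H j l * s k)) -> (exists2 x, ospan tof s x & r x = 1) ->
  v != 0 -> v *m blockrep r H = lam *: v -> integralOver i lam.
Proof.
move=> rZ Hs [x1 [c1 x1E] rx1] v0 vH.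
pose V (j : 'I_b) : 'rV_n.+1 := submxrow v j.
have vE : v = \mxrow_j V j by rewrite submxrowK.
have HV j : lam *: V j = \sum_l V l *m r (H l j).
  have := congr1 (fun w : 'rV_(\sum_(j < b) n.+1) => submxrow w j) vH.
  rewrite {1}vE mul_mxrow_mxblock mxrowK => ->.
  by apply/rowP=> k; rewrite !mxE.
have /choice[q qP] : forall jlk : 'I_b * 'I_b * 'I_m,
    exists q : 'I_m -> o, H jlk.1.1 jlk.1.2 * s jlk.2 = \sum_p tof (q p) *: s p.
  by move=> [[j l] k]; have [q qE] := Hs j l k; exists q.
have [j0 Vj0] : exists j, V j != 0.
  apply: contrapT => nV; move/eqP: v0; apply; rewrite vE -(mxrow0 (q_ := fun=> n.+1)).
  by apply/eq_mxrow => j; apply/eqP/negPn/negP=> nz; apply: nV; exists j.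
have [k0 Vk0] : exists k, V j0 *m r (s k) != 0.
  apply: contrapT => nV; move/eqP: Vj0; apply.
  rewrite -[LHS]mulmx1 -[1%:M]/(1 : 'M_n.+1) -rx1 x1E rmorph_sum mulmx_sumr big1 // => k _.
  rewrite rZ -scalemxAr; apply/eqP; rewrite scaler_eq0; apply/orP; right.
  by apply/negPn/negP=> nz; apply: nV; exists k.
have [t0 Vt0] : exists t, (V j0 *m r (s k0)) 0 t != 0.
  apply: contrapT => nV; move/eqP: Vk0; apply; apply/rowP=> t; rewrite [RHS]mxE.
  by apply/eqP/negPn/negP=> nz; apply: nV; exists t.
apply: (integral_eigen i (fun jk : 'I_b * 'I_m => (V jk.1 *m r (s jk.2)) 0 t0)
  (fun jk lp => q (lp.1, jk.1, jk.2) lp.2)); first by exists (j0, k0).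
move=> [j k] /=.
have -> : lam * (V j *m r (s k)) 0 t0 = (lam *: V j *m r (s k)) 0 t0.
  by rewrite -scalemxAl [RHS]mxE.
rewrite HV mulmx_suml summxE.
rewrite -(pair_bigA _ (fun l p => i (q (l, j, k) p) * (V l *m r (s p)) 0 t0)) /=.
apply: eq_bigr => l _; rewrite -mulmxA -[_ *m r (s k)]rmorphM (qP (l, j, k)) rmorph_sum.
rewrite mulmx_sumr summxE; apply: eq_bigr => p _.
by rewrite rZ -scalemxAr [LHS]mxE.
Qed.

End Eigen.

Lemma map_blockrep {A : nzRingType} {L L' : comNzRingType} {n a b : nat}
    (t : {rmorphism L -> L'}) (rho : {rmorphism A -> 'M[L]_n.+1}) (H : 'M[A]_(a, b)) :
  map_mx t (blockrep rho H) = blockrep (map_mx t \o rho) H.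
Proof. by apply/matrixP=> k l; rewrite !mxE. Qed.

(** Meaningful for every size [m], here a sum over the blocks; for positive [m] it is the usual
    power. *)
Definition mxpow {R : pzRingType} {m : nat} (S : 'M[R]_m) k := iter k (mulmx S) 1%:M.

(** Write Cayley-Hamilton as Q(S) S = -p(0), with p(0) the determinant up to sign; multiply by the
    adjugate and cancel the determinant. *)
Lemma adj_charpoly {L : fieldType} {m : nat} (S : 'M[L]_m) : S \in unitmx ->
  exists q, \adj S = \sum_(k < m) ((-1) ^+ q * (char_poly S)`_k.+1) *: mxpow S k.
Proof.
case: m S => [|m] S uS; first by exists 0%N; rewrite big_ord0 [LHS]thinmx0.
exists m; set p := char_poly S.
have powE k : mxpow S k = S ^+ k by elim: k => //= k ->; rewrite exprS.
have : horner_mx S p = 0 by apply: Cayley_Hamilton.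
have -> : horner_mx S p = \sum_(k < m.+2) p`_k *: S ^+ k.
  rewrite -[p in LHS]coefK poly_def size_char_poly rmorph_sum; apply: eq_bigr => k _.
  by rewrite -mul_polyC rmorphM rmorphXn /= horner_mx_C horner_mx_X -mul_scalar_mx.
rewrite big_ord_recl /= char_poly_det expr0 => /eqP; rewrite addrC addr_eq0 => /eqP CH.
have : (\sum_(k < m.+1) p`_k.+1 *: mxpow S k) *m S *m \adj S =
   - ((-1) ^+ m.+1 * \det S) *: \adj S.
  rewrite mulmx_suml scaleNr -mul_scalar_mx -mulNmx; congr (_ *m _).
  rewrite -scalemx1 -[RHS]CH; apply: eq_bigr => k _.
  by rewrite powE -scalemxAl ?lift0 exprSr.
have dS : \det S != 0 by move: uS; rewrite unitmxE unitfE.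
rewrite -mulmxA mul_mx_adj mul_mx_scalar.
have -> : - ((-1) ^+ m.+1 * \det S) = \det S * (-1) ^+ m :> L.
  by rewrite exprS mulN1r mulNr opprK mulrC.
rewrite -scalerA => /(scalerI dS) QE.
rewrite -[LHS](signrZK m) -QE scaler_sumr; apply: eq_bigr => k _.
by rewrite scalerA.
Qed.

(** Right multiplication by [H] on (A e)^b is injective because [rho] is faithful there, hence
    surjective by dimension. The rows of [H'] are preimages of the unit vectors. *)
Lemma blockrep_inverse {F : fieldType} {A : falgType F} {e : A} {L : fieldType} {n b : nat}
    (rho : {rmorphism A -> 'M[L]_n.+1}) (H : 'M[A]_b) :
  semisimple_algebra A -> primitive_central_idempotent e -> is_splitting e rho ->
  \det (blockrep rho H) != 0 ->
  exists H' : 'M[A]_b, H' *m H = e%:M /\ forall j k, H' j k * e = H' j k.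
Proof.
move=> ss pe sp dH; have [[eZ ee] _ _] := pe.
have eC x : e * x = x * e by apply: (memZP _ eZ).
(* Multiplication by [H] on the e-part, completed by the identity on the (1 - e)-part to an
   endomorphism of A^b. *)
pose f (v : {ffun 'I_b -> A}) : {ffun 'I_b -> A} :=
  [ffun j => \sum_k v k * e * H k j + v j * (1 - e)].
have fL : linear f.
  move=> c u v; apply/ffunP=> j; rewrite !ffunE scalerDr addrACA; congr (_ + _).
    rewrite scaler_sumr -big_split; apply: eq_bigr => k _.
    by rewrite !ffunE !mulrDl !scalerAl.
  by rewrite mulrDl scalerAl.
pose fl : {linear {ffun 'I_b -> A} -> {ffun 'I_b -> A}} :=
  HB.pack f (GRing.isLinear.Build F _ _ _ f fL).
have fe v j : f v j * e = \sum_k v k * e * H k j.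
  rewrite ffunE mulrDl -mulrA mulrBl mul1r ee subrr mulr0 addr0 mulr_suml.
  by apply: eq_bigr => k _; rewrite -mulrA -(eC (H k j)) mulrA -(mulrA (v k)) ee.
have finj v : f v = 0 -> v = 0.
  move=> fv0; have ve j : v j * e = 0.
    pose r : 'M[A]_(1, b) := \row_k (v k * e).
    have : blockrep rho (r *m H) = 0.
      rewrite -(mxblock0 (p_ := fun=> n.+1) (q_ := fun=> n.+1)).
      apply/eq_mxblockP => k l; rewrite mxE -(rmorph0 rho); congr (rho _).
      under eq_bigr do rewrite mxE.
      by rewrite -fe fv0 ffunE mul0r.
    rewrite blockrepM => /(congr1 (fun X => X *m invmx (blockrep rho H))).
    rewrite mul0mx mulmxK ?unitmxE ?unitfE // => r0.
    have /(splitting_inj rho pe sp ss) : rho (v j * e) = 0.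
      have := blockrep_inj rho r 0 _ 0 j; rewrite mxE mxE rmorph0; apply.
      by rewrite r0 blockrep0.
    by rewrite -mulrA ee.
  apply/ffunP=> j; have := congr1 (fun w : {ffun _} => w j) fv0.
  rewrite !ffunE big1 => [|k _]; last by rewrite ve mul0r.
  by rewrite add0r mulrBr mulr1 ve subr0.
have fsurj w : exists v, f v = w.
  have k0 : lker (linfun fl) == 0%VS.
    apply/lker0P=> u v; rewrite !lfunE /= => uv; apply/eqP; rewrite -subr_eq0; apply/eqP.
    by apply: finj; have -> : f (u - v) = f u - f v := linearB fl u v;
      apply/eqP; rewrite subr_eq0; apply/eqP.
  have : w \in limg (linfun fl) by rewrite (lker0_limgf k0) memvf.
  by case/memv_imgP=> v _ ->; exists v; rewrite lfunE.
have /choice[v vP] : forall j, exists v, f v = [ffun k => (j == k)%:R * e].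
  by move=> j; apply: fsurj.
exists (\matrix_(j, k) (v j k * e)); split=> [|j k]; last by rewrite mxE -mulrA ee.
apply/matrixP=> j k; rewrite !mxE; under eq_bigr do rewrite mxE.
by rewrite -fe vP ffunE -mulrA ee mulr_natl.
Qed.

Section Components.
Context {o : idomainType} {A : falgType {fraction o}}.
Local Notation tof := (@tofrac o : {rmorphism o -> {fraction o}}).

(** The adjugate identity restricted to a direct summand [G] with unit [eps]. *)
Definition has_adjugate (G : set A) (eps : A) {b : nat} (H : 'M[A]_b) (z : A) : Prop :=
  G (z * eps) /\ exists K : 'M[A]_b, (forall i j, G (K i j)) /\ K *m H = (z * eps)%:M.

Lemma is_orderP (B : {aspace A}) (X : set A) : is_order B X ->
  [/\ X (algid B), osubmodule tof X, forall x y, X x -> X y -> X (x * y) &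
    exists n (s : n.-tuple A), X = ospan tof (fun i : 'I_n => s`_i) /\ <<s>>%VS = B].
Proof.
case=> X1 XB XM [n [s [Xs sB]]].
have XE : X = ospan tof (fun i : 'I_n => s`_i) by apply/seteqP; split=> x /Xs.
by split=> //; [rewrite XE; apply: ospan_submodule | exists n, s].
Qed.

Lemma osubmoduleB (X : set A) x y : osubmodule tof X -> X x -> X y -> X (x - y).
Proof.
case=> _ XD XZ Xx Xy; apply: XD => //.
by rewrite -scaleN1r -(rmorphN1 tof); apply: XZ.
Qed.

Context {B : {aspace A}} {G : set A} {eps : A}.
Hypotheses (noeth : noetherian o) (ss : semisimple_algebra A).
Hypotheses (G_max : is_maximal_order B G) (Beps : forall x, x * eps \in B).

(* Enlarging a maximal order [G] by the elements of the simple component [A e] *)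
(* whose image lies in [O_1 rho(G)], where [O_1] is a finite integral          *)
(* extension of [o] in the splitting field, again yields an order.             *)
Lemma maximal_order_absorbs {e : A} {L : fieldType} {n : nat}
    (rho : {rmorphism A -> 'M[L]_n.+1}) (i : {rmorphism o -> L}) {J : finType} (g : J -> L^o) :
  primitive_central_idempotent e -> is_splitting e rho -> eps * e = e ->
  (forall c x, rho (tof c *: x) = i c *: rho x) -> ospan i g 1 ->
  (forall a b, ospan i g a -> ospan i g b -> ospan i g (a * b)) ->
  forall N : set 'M[L]_n.+1, osubmodule i N ->
  (forall a x, ospan i g a -> G x -> N (a *: rho x)) ->
  (forall W : set 'M[L]_n.+1, osubmodule i W ->
     (forall a x, ospan i g a -> G x -> W (a *: rho x)) -> N `<=` W) ->
  forall x, x * e = x -> N (rho x) -> G x.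
Proof.
move=> pe sp epse rhoZ g1 gM N sN NaG Nmin.
have [ord_G G_absorb] := G_max; have [GB sG GM [m [s [Gs sB]]]] := is_orderP _ _ ord_G.
have [G0 GD GZ] := sG.
have [[eZ ee] _ _] := pe; have eC x : e * x = x * e := memZP _ eZ x.
have [N0 ND NZ] := sN.
(* [N] is known only as the least submodule containing the products a rho(x), so each factor in turn
   is reduced to such a product. *)
have NM X Y : N X -> N Y -> N (X * Y).
  have sub1 Y' : osubmodule i [set X | N (X * Y')].
    split; first by rewrite /= mul0r.
      by move=> U V; rewrite /= mulrDl; apply: ND.
    by move=> c U; rewrite /= -scalerAl; apply: NZ.
  move=> NX NY; apply: (Nmin [set X | N (X * Y)]) NX => // a x ga Gx /=.
  have sub2 : osubmodule i [set Y | N (a *: rho x * Y)].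
    split; first by rewrite /= mulr0.
      by move=> U V; rewrite /= mulrDr; apply: ND.
    by move=> c U; rewrite /= -scalerAr; apply: NZ.
  apply: (Nmin _ sub2) NY => c y gc Gy /=.
  by rewrite -scalerAl -scalerAr scalerA -rmorphM; apply: NaG; [apply: gM | apply: GM].
have NG x : G x -> N (rho x) by move=> Gx; rewrite -[rho x]scale1r; apply: NaG.
pose E : set A := [set x | x * e = x /\ N (rho x)].
have sE : osubmodule tof E.
  split; first by rewrite /E /= mul0r rmorph0.
    by move=> x y [xe Nx] [ye Ny]; split; rewrite ?mulrDl ?xe ?ye // rmorphD; apply: ND.
  by move=> c x [xe Nx]; split; rewrite ?rhoZ -?scalerAl ?xe //; apply: NZ.
have EM x y : E x -> E y -> E (x * y).
  by move=> [xe Nx] [ye Ny]; split; rewrite ?rmorphM -?mulrA ?ye //; apply: NM.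
have GE x y : G x -> E y -> E (x * y).
  by move=> Gx [ye Ny]; split; rewrite ?rmorphM -?mulrA ?ye //; apply: NM => //; apply: NG.
have EG x y : E x -> G y -> E (x * y).
  move=> [xe Nx] Gy; split; last by rewrite rmorphM; apply: NM => //; apply: NG.
  by rewrite -mulrA -eC mulrA xe.
have [r [w [Ew wE]]] : exists r (w : 'I_r -> A), (forall k, E (w k)) /\ E `<=` ospan tof w.
  pose gs (jk : J * 'I_m) : 'M[L]_n.+1 := g jk.1 *: rho s`_jk.2.
  apply: (fg_of_injection tof i rho E gs) => //.
    by move=> x [xe _] rx; rewrite -xe; apply: (splitting_inj rho pe sp ss).
  move=> x [_]; apply: Nmin; first exact: ospan_submodule.
  have sgs := ospan_submodule i gs; have [_ _ gsZ] := sgs.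
  move=> a y [c ->]; rewrite Gs => -[d ->].
  rewrite scaler_suml; apply: (osubmodule_sum i) => // j _.
  rewrite rmorph_sum scaler_sumr; apply: (osubmodule_sum i) => // k _.
  rewrite rhoZ scalerA [_ * i _]mulrC -scalerA -[_ *: g j]/(i (c j) * g j : L) -scalerA.
  by apply/gsZ/gsZ; apply: (ospan_gen i gs (j, k)).
pose Y : set A := [set x | exists u v, [/\ G u, E v & x = u + v]].
have GY : G `<=` Y by move=> x Gx; exists x, 0; rewrite addr0; split=> //; case: sE.
have ord_Y : is_order B Y.
  have [E0 ED EZ] := sE.
  split; first exact: GY.
  - move=> _ _ [u [v [Gu Ev ->]]] [u' [v' [Gu' Ev' ->]]]; exists (u - u'), (v - v').
    by split; [apply: (osubmoduleB) | apply: (osubmoduleB) | rewrite opprD addrACA].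
  - move=> _ _ [u [v [Gu Ev ->]]] [u' [v' [Gu' Ev' ->]]].
    exists (u * u'), (u * v' + (v * u' + v * v')); split; first exact: GM.
      by apply: (ED) => //; [apply: GE | apply: (ED); [apply: EG | apply: EM]].
    by rewrite mulrDl !mulrDr !addrA.
  - exists (m + r)%N, (cat_tuple s (mktuple w)); split.
      have nthl (k : 'I_m) : (cat_tuple s (mktuple w))`_(lshift r k) = s`_k.
        by rewrite nth_cat size_tuple /= ltn_ord.
      have nthr (k : 'I_r) : (cat_tuple s (mktuple w))`_(rshift m k) = w k.
        rewrite nth_cat size_tuple /= ltnNge leq_addr /= addKn.
        by rewrite -[RHS](tnth_mktuple w) (tnth_nth 0).
      move=> x; split=> [[u [v [Gu Ev ->]]]|[c ->]].
        move: Gu; rewrite Gs => -[c ->]; have [d ->] := wE _ Ev.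
        exists (fun k => match split k with inl k1 => c k1 | inr k2 => d k2 end).
        rewrite big_split_ord; congr (_ + _); apply: eq_bigr => k _.
          by rewrite (unsplitK (inl k)) nthl.
        by rewrite (unsplitK (inr k)) nthr.
      exists (\sum_k tof (c (lshift r k)) *: s`_k), (\sum_k tof (c (rshift m k)) *: w k).
      split.
      + by apply: (osubmodule_sum tof) => // k _; apply: (GZ); rewrite Gs; apply: (ospan_gen tof).
      + by apply: (osubmodule_sum tof) => // k _; apply: EZ.
      + by rewrite big_split_ord; congr (_ + _); apply: eq_bigr => k _; rewrite ?nthl ?nthr.
    (* The new generators lie in A e, hence in A eps, which is inside [B]; the span does not
       grow. *)
    rewrite span_cat sB; apply/eqP; rewrite eqEsubv addvSl andbT subv_add subvv /=.
    apply/span_subvP=> x /mapP[k _ ->]; have [we _] := Ew k.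
    have -> : w k = w k * e * eps by rewrite -mulrA (memZP _ eZ) epse.
    exact: Beps.
by move=> x xe Nx; apply: (G_absorb Y) => //; exists 0, x; rewrite add0r.
Qed.
End Components.

Section Components.
Context {o : idomainType} {A : falgType {fraction o}}.
Local Notation tof := (@tofrac o : {rmorphism o -> {fraction o}}).
Hypotheses (noeth : noetherian o) (ss : semisimple_algebra A).

(** The matrix K is constructed on each primitive e below [eps] and summed. There it is z times the
    inverse of [H], whose entries are integral because their images come from an adjugate. *)
Lemma maximal_order_adjugate (B : {aspace A}) (G : set A) (eps : A) b (H : 'M[A]_b) z :
  is_maximal_order B G -> central_idempotent eps -> G eps -> (forall x, x * eps \in B) ->
  (forall x, G x -> x * eps = x) -> (forall j k, G (H j k * eps)) -> is_nr H z ->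
  has_adjugate G eps H z.
Proof.
move=> G_max c_eps G_eps Beps G_unit HG [zZ nrz].
have [GB [G0 GD GZ] GM [m [s [Gs sB]]]] := is_orderP _ _ (proj1 G_max).
have [epsZ epseps] := c_eps; have epsC x : eps * x = x * eps := memZP _ epsZ x.
have Gsum (I : finType) (x : I -> A) : (forall k, G (x k)) -> G (\sum_k x k).
  by move=> Gx; elim/big_ind: _.
suff : forall u, central_idempotent u -> G (z * eps * u) /\ exists K : 'M[A]_b,
    (forall i j, G (K i j)) /\ K *m H = (z * eps * u)%:M.
  have c1 : central_idempotent (1 : A).
    by split; [apply/memZP=> y; rewrite mul1r mulr1 | rewrite mulr1].
  by move=> /(_ 1 c1); rewrite mulr1.
have zero : G 0 /\ exists K : 'M[A]_b, (forall i j, G (K i j)) /\ K *m H = 0%:M.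
  by split=> //; exists 0; split=> [i j|]; rewrite ?mxE // mul0mx raddf0.
apply: central_idempotent_ind => [|e pe|u v _ _ _ [Gu [K [GK KH]]] [Gv [K' [GK' KH']]]].
- by rewrite mulr0.
- have [ce _ _] := pe; have [eZ ee] := ce.
  have [ee0|epse] := primitive_le e eps pe c_eps; first by rewrite -mulrA ee0 mulr0.
  (* If the reduced norm vanishes on this component, K = 0 serves. *)
  rewrite -mulrA epse; have [->//|ze0] := eqVneq (z * e) 0.
  have [L [n [rho sp]]] := splitting_exists ss e pe.
  have [iota iotaP] := splitting_base rho sp.
  pose i : {rmorphism o -> L} := iota \o tof.
  have rhoZ c x : rho (tof c *: x) = i c *: rho x by rewrite iotaP.
  have rhoeps : rho eps = 1.
    by rewrite -[rho eps]mulr1 -(proj1 sp) -rmorphM epse (proj1 sp).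
  have rhoE x : rho (x * eps) = rho x by rewrite rmorphM rhoeps mulr1.
  have [c rz] := splitting_central rho sp z zZ.
  pose S := blockrep rho H.
  have cS : c = \det S.
    have := nrz e pe L n rho sp; rewrite rz -/(blockrep rho H) => /matrixP/(_ 0 0).
    by rewrite !mxE eqxx !mulr1n.
  have c0 : c != 0.
    apply: contraNneq ze0 => c0; apply/eqP/(splitting_inj rho pe sp ss).
    by rewrite rz c0 raddf0.
  have coef_int k : integralOver i (char_poly S)`_k.
    apply: charpoly_integral => L' t lam v v0 vS.
    rewrite (map_blockrep t rho H) in vS.
    have tP (a : o) x : (map_mx t \o rho) (tof a *: x) = (t \o i) a *: (map_mx t \o rho) x.
      by rewrite /= rhoZ map_mxZ.
    have HGs j l (k' : 'I_m) : ospan tof (fun k : 'I_m => s`_k) (H j l * s`_k').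
      have Gk : G s`_k' by rewrite Gs; apply: (ospan_gen tof (fun k : 'I_m => s`_k)).
      by rewrite -Gs -(G_unit _ Gk) -epsC mulrA; apply: GM.
    apply: (blockrep_eigen tof (t \o i) (map_mx t \o rho) (fun k : 'I_m => s`_k) H lam v) => //.
    exists eps; first by rewrite -Gs.
    by rewrite /= rhoeps rmorph1.
  (* [ospan i g] is a subring of L, finite over o, containing all coefficients of the characteristic
     polynomial. *)
  have [J [g [g1 gcoef gM]]] : exists (J : finType) (g : J -> L^o), [/\ ospan i g 1,
      forall k, ospan i g (char_poly S)`_k &
      forall x y, ospan i g x -> ospan i g y -> ospan i g (x * y)].
    have [|J [g [g1 gc gM]]] := integral_fg i (char_poly S); first exact/integral_poly.
    exists J, g; split=> // k; have [kS|kS] := ltnP k (size (char_poly S)).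
      exact/gc/mem_nth.
    by rewrite nth_default //; case: (ospan_submodule i g).
  have [_ gD gZ] := ospan_submodule i g.
  have gsign k : ospan i g ((-1) ^+ k).
    rewrite -[_ ^+ _]mulr1 -[(-1) ^+ k](rmorph_sign i); exact: gZ.
  pose gs (jk : J * 'I_m) : 'M[L]_n.+1 := g jk.1 *: rho s`_jk.2.
  have sgs := ospan_submodule i gs; have [gs0 gsD gsZ] := sgs.
  have NaG a x : ospan i g a -> G x -> ospan i gs (a *: rho x).
    move=> [a' ->]; rewrite Gs => -[d ->].
    rewrite scaler_suml; apply: (osubmodule_sum i) => // j _.
    rewrite rmorph_sum scaler_sumr; apply: (osubmodule_sum i) => // k _.
    rewrite rhoZ scalerA [_ * i _]mulrC -scalerA -[_ *: g j]/(i (a' j) * g j : L) -scalerA.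
    by apply/gsZ/gsZ; apply: (ospan_gen i gs (j, k)).
  have absorb : forall x, x * e = x -> ospan i gs (rho x) -> G x.
    apply: (maximal_order_absorbs noeth ss G_max Beps rho i g pe sp epse rhoZ g1 gM) => //.
    move=> W sW WaG; apply: ospan_sub => // -[j k]; apply: WaG; first exact: ospan_gen.
    by rewrite Gs; apply: (ospan_gen tof (fun k : 'I_m => s`_k)).
  have gc : ospan i g c.
    by rewrite cS -[\det S](signrMK (\sum_(j < b) n.+1)) -char_poly_det; apply: gM.
  split.
    apply: absorb; first by rewrite -mulrA ee.
    by rewrite rmorphM (proj1 sp) mulr1 rz -scalemx1 -[1%:M]/(1 : 'M_n.+1) -rhoeps; apply: NaG.
  have [|H' [H'H H'e]] := blockrep_inverse rho H ss pe sp; first by rewrite -cS.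
  exists (z%:M *m H'); split; last by rewrite -mulmxA H'H -scalar_mxM.
  move=> j k; apply: absorb; first by rewrite mul_scalar_mx mxE -mulrA H'e.
  have powE q : mxpow S q = blockrep rho (mxpow H q).
    elim: q => [|q IH] /=; last by rewrite blockrepM -IH.
    by rewrite (blockrep_scalar rho 1 1) // rmorph1.
  have powG q j' k' : G (mxpow H q j' k' * eps).
    elim: q j' k' => [|q IH] j' k'.
      by rewrite mxE mulrb; case: eqP => _; rewrite ?mul1r ?mul0r.
    rewrite mxE mulr_suml; apply: Gsum => l.
    have -> x y : x * y * eps = (x * eps) * (y * eps).
      by rewrite -[RHS]mulrA (mulrA eps) epsC -(mulrA y) epseps mulrA.
    exact: GM.
  (* Since c = det S, the matrix z H' maps to the adjugate of S, hence to a combination of powers of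
     S with coefficients in [ospan i g]; each block then lies in the module that [G] absorbs. *)
  have adjE : blockrep rho (z%:M *m H') = \adj S.
    rewrite blockrepM (blockrep_scalar rho z c) //.
    have H'S : blockrep rho H' *m S = 1%:M.
      by rewrite -blockrepM H'H (blockrep_scalar rho e 1) // (proj1 sp).
    by rewrite -[RHS]mul1mx -H'S -mulmxA mul_mx_adj -cS scalar_mxC.
  have [|q adjS] := adj_charpoly S; first by rewrite unitmxE unitfE -cS.
  have -> : rho ((z%:M *m H') j k) =
      \sum_(l < \sum_(j < b) n.+1) ((-1) ^+ q * (char_poly S)`_l.+1) *: rho (mxpow H l j k * eps).
    rewrite -[LHS](mxblockK (fun j k => rho ((z%:M *m H') j k))) -/(blockrep _ _) adjE adjS.
    apply/matrixP=> p p'; rewrite mxE !summxE; apply: eq_bigr => l _.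
    rewrite powE rhoE mxE [RHS]mxE.
    by rewrite -[in RHS](mxblockK (fun j k => rho (mxpow H l j k))) [in RHS]mxE.
  apply: (osubmodule_sum i) => // l _; apply: NaG => //; exact: gM.
- split; first by rewrite mulrDr; apply: GD.
  exists (K + K'); split=> [i j|]; first by rewrite mxE; apply: GD.
  by rewrite mulmxDl KH KH' mulrDr raddfD.
Qed.
End Components.

(** * Matrix rings over commutative rings *)

Section MatrixRing.
Context {R : comNzRingType} {L : fieldType} {a n : nat}
  (th : {rmorphism 'M[R]_a.+1 -> 'M[L]_n.+1}) (sg : {rmorphism R -> L}).
Hypothesis th_scalar : forall r, th r%:M = (sg r)%:M.
Hypothesis th_span : forall P : set 'M[L]_n.+1, P 0 ->
  (forall X Y, P X -> P Y -> P (X + Y)) -> (forall c X, P X -> P (c *: X)) ->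
  (forall u, P (th u)) -> forall X, P X.

(* The rows of [W] are [w E_(0 k)], for [w] a nonzero row of the image         *)
(* [E_(0 0)] of the matrix unit.                                               *)
Lemma matrix_ring_intertwiner : a = n /\ exists W : 'M[L]_(a.+1, n.+1),
  row_free W /\ forall u, W *m th u = map_mx sg u *m W.
Proof.
pose E k l := th (delta_mx k l).
have EM k l q : E k l *m E l q = E k q.
  by rewrite -[_ *m _]rmorphM -[_ * _]/(_ *m _) mul_delta_mx.
have thZ r u : th (r *: u) = sg r *: th u.
  by rewrite -mul_scalar_mx rmorphM th_scalar -mul_scalar_mx.
have [j0 [t0 w0t]] : exists j t, E 0 0 j t != 0.
  apply: contrapT => nE; have E0 : E 0 0 = 0.
    apply/matrixP=> j t; rewrite [RHS]mxE; apply/eqP/negPn/negP=> nz.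
    by apply: nE; exists j, t.
  have : th 1%:M = 0.
    rewrite scalar_mx_sum_delta rmorph_sum big1 // => k _.
    by rewrite scale1r -/(E k k) -(EM k 0 k) -(EM k 0 0) E0 mulmx0 mul0mx.
  by move/eqP; rewrite rmorph1 oner_eq0.
pose w := row j0 (E 0 0).
have wE : w *m E 0 0 = w by rewrite -row_mul EM.
have w0 : w 0 t0 != 0 by rewrite mxE.
clearbody w.
pose W := \matrix_k (w *m E 0 k).
have rowW k : row k W = w *m E 0 k by rewrite rowK.
have WE u : W *m th u = map_mx sg u *m W.
  apply/row_matrixP=> k; rewrite row_mul rowW -mulmxA row_mul [RHS]mulmx_sum_row.
  rewrite -[E 0 k *m _]rmorphM.
  have -> : delta_mx 0 k * u = \sum_l u k l *: delta_mx 0 l.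
    rewrite -[LHS]/(delta_mx 0 k *m u) {1}(matrix_sum_delta u) mulmx_sumr (bigD1 k) //=.
    rewrite [X in _ + X]big1 ?addr0 => [|q qk].
      by rewrite mulmx_sumr; apply: eq_bigr => l _; rewrite -scalemxAr mul_delta_mx.
    rewrite mulmx_sumr big1 // => l _.
    by rewrite -scalemxAr mul_delta_mx_cond eq_sym (negPf qk) mulr0n scaler0.
  rewrite rmorph_sum mulmx_sumr; apply: eq_bigr => l _.
  by rewrite thZ -scalemxAr !mxE rowW.
have row0W : row 0 W = w by rewrite rowW wE.
(* Multiplying a relation v W = 0 by E_(l 0) isolates v_l w. *)
have freeW : row_free W.
  apply: inj_row_free => v vW; apply/rowP=> l.
  have : v *m W *m E l 0 = v 0 l *: w.
    rewrite -mulmxA WE map_delta_mx mulmxA -row0W.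
    have -> : v *m delta_mx l 0 = v 0 l *: delta_mx 0 0 :> 'rV_a.+1.
      apply/rowP=> q; rewrite !mxE (bigD1 l) //= big1 ?addr0; first by rewrite mxE eqxx.
      by move=> r rl; rewrite mxE (negPf rl) mulr0.
    by rewrite -scalemxAl -rowE.
  rewrite vW mul0mx => /rowP/(_ t0); rewrite !mxE => /esym/eqP.
  by rewrite mulf_eq0 (negPf w0) orbF => /eqP.
(* The row space of [W] is stable under the image of [th], hence under all matrices; containing the
   nonzero w, it is everything. *)
have fullW : row_full W.
  have stable X : (W *m X <= W)%MS.
    apply: (th_span [set X | (W *m X <= W)%MS]) => [|Y Z|c Y|u] /=.
    - by rewrite mulmx0 sub0mx.
    - by move=> WY WZ; rewrite mulmxDr addmx_sub.
    - by move=> WY; rewrite -scalemxAr scalemx_sub.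
    - by rewrite WE submxMl.
  rewrite -sub1mx; apply/row_subP=> k.
  pose X : 'M[L]_n.+1 := (w 0 t0)^-1 *: delta_mx t0 k.
  have -> : row k 1%:M = w *m X.
    apply/rowP=> q; rewrite !mxE (bigD1 t0) //= big1 ?addr0 => [|r rt].
      by rewrite !mxE eqxx /= mulrA mulfV ?mul1r // eq_sym.
    by rewrite !mxE (negPf rt) !mulr0.
  apply: submx_trans (stable X); rewrite -row0W -row_mul; exact: row_sub.
split; last by exists W.
by move: freeW fullW; rewrite /row_free /row_full => /eqP-> /eqP[].
Qed.

(** Conjugation by the block diagonal of [W] turns [th] into the entrywise map [sg], which commutes
    with determinants. *)
Lemma det_matrix_ring {b : nat} (h : 'M['M[R]_a.+1]_b) :
  \det (blockrep th h) = sg (\det (\mxblock_(i < b, j < b) h i j)).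
Proof.
have [an [W [freeW WE]]] := matrix_ring_intertwiner.
case: n / an th W freeW WE => th' W freeW WE.
have uW : W \in unitmx by rewrite -row_free_unit.
pose WW : 'M_(\sum_(i < b) a.+1) := \mxdiag_(i < b) W.
have uWW : WW \in unitmx.
  have : WW *m (\mxdiag_(i < b) invmx W) = 1%:M.
    rewrite -mxdiagZ {2}/mxdiag mul_mxdiag_mxblock; apply/eq_mxblockP => i j.
    by case: eqVneq => _; rewrite ?mulmx0 // !conform_mx_id mulmxV.
  by case/mulmx1_unit.
have : WW *m blockrep th' h = map_mx sg (\mxblock_(i < b, j < b) h i j) *m WW.
  have -> : map_mx sg (\mxblock_(i < b, j < b) h i j) =
      \mxblock_(i < b, j < b) map_mx sg (h i j).
    by apply/matrixP=> k l; rewrite !mxE.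
  rewrite mul_mxdiag_mxblock mul_mxblock_mxdiag; apply/eq_mxblockP => i j.
  exact: WE.
move/(congr1 determinant); rewrite !det_mulmx mulrC det_map_mx; apply: mulIf.
by rewrite -unitfE -unitmxE.
Qed.

End MatrixRing.

(** Unfold [H] into one large matrix [hm] over the commutative ring R: its determinant gives the
    reduced norm on every component, and the blocks of its adjugate give K. *)
Lemma matrix_ring_adjugate {o : idomainType} {A : falgType {fraction o}}
    (G : set A) (eps : A) b (H : 'M[A]_b) z :
  semisimple_algebra A -> is_comm_matrix_ring G -> central_idempotent eps -> G eps ->
  (forall x, exists (m : nat) (f : 'I_m -> {fraction o}) (y : 'I_m -> A),
     (forall k, G (y k)) /\ x * eps = \sum_k f k *: y k) ->
  (forall x, G x -> x * eps = x) -> (forall j k, G (H j k * eps)) -> is_nr H z ->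
  has_adjugate G eps H z.
Proof.
move=> ss [R [a [phi [phiM phi_inj phiG]]]] c_eps G_eps Gspan G_unit HG [zZ nrz].
have [epsZ epseps] := c_eps; have epsC x : eps * x = x * eps := memZP _ epsZ x.
have Gphi u : G (phi u) by rewrite -phiG; exists u.
have phiP x : G x -> exists u, phi u = x by rewrite -phiG => -[u _ <-]; exists u.
have phi_eps u : phi u * eps = phi u by apply: G_unit.
have phi1 : phi 1%:M = eps.
  by have [u uE] := phiP _ G_eps; rewrite -(phi_eps 1%:M) -uE -phiM mul1mx.
have /choice[h' h'P] : forall jk : 'I_b * 'I_b, exists u, phi u = H jk.1 jk.2 * eps.
  by move=> [j k]; apply: phiP.
pose h : 'M['M[R]_a.+1]_b := \matrix_(j, k) h' (j, k).
have hP j k : phi (h j k) = H j k * eps by rewrite mxE h'P.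
pose hm := \mxblock_(j < b, k < b) h j k.
pose d := \det hm.
(* Scalars commute with [G], and [G] spans A eps over the field of fractions. *)
have phiZ r : phi r%:M \in 'Z({:A})%VS.
  apply/memZP=> x; have [m [f [y [Gy xE]]]] := Gspan x.
  have -> : phi r%:M * x = phi r%:M * (x * eps).
    by rewrite -{1}phi_eps -mulrA epsC.
  have -> : x * phi r%:M = x * eps * phi r%:M by rewrite -mulrA epsC phi_eps.
  rewrite xE mulr_sumr mulr_suml; apply: eq_bigr => k _.
  have [u <-] := phiP _ (Gy k).
  by rewrite -scalerAl -scalerAr -!phiM scalar_mxC.
have zE : z * eps = phi d%:M.
  suff : forall u, central_idempotent u -> z * eps * u = phi d%:M * u.
    have c1 : central_idempotent (1 : A).
      by split; [apply/memZP=> y; rewrite mul1r mulr1 | rewrite mulr1].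
    by move=> /(_ 1 c1); rewrite !mulr1.
  apply: central_idempotent_ind => [|e pe|u v _ _ _ hu hv].
  - by rewrite !mulr0.
  - have [ee0|epse] := primitive_le e eps pe c_eps.
      by rewrite -mulrA ee0 -phi_eps -(mulrA _ eps) ee0 !mulr0.
    rewrite -mulrA epse.
    have [L [n [rho sp]]] := splitting_exists ss e pe.
    have [iota iotaP] := splitting_base rho sp.
    have rhoeps : rho eps = 1.
      by rewrite -[rho eps]mulr1 -(proj1 sp) -rmorphM epse (proj1 sp).
    pose th0 (u : 'M[R]_a.+1) := rho (phi u).
    have th0B : zmod_morphism th0 by move=> u v; rewrite /th0 !raddfB.
    have th0M : monoid_morphism th0.
      by split=> [|u v]; rewrite /th0 ?phi1 // phiM rmorphM.
    pose th : {rmorphism 'M[R]_a.+1 -> 'M[L]_n.+1} := HB.pack th0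
      (GRing.isZmodMorphism.Build _ _ th0 th0B) (GRing.isMonoidMorphism.Build _ _ th0 th0M).
    have [r|sg sgP] := scalar_rmorphism (th \o (@scalar_mx R a.+1)).
      exact: (splitting_central rho sp (phi r%:M) (phiZ r)).
    have th_span (P : set 'M[L]_n.+1) : P 0 ->
        (forall X Y, P X -> P Y -> P (X + Y)) -> (forall c X, P X -> P (c *: X)) ->
        (forall u, P (th u)) -> forall X, P X.
      move=> P0 PD PZ Pth X; have [r [c [x ->]]] := proj2 sp X.
      elim/big_ind: _ => // k _; apply: (PZ).
      have -> : rho (x k) = rho (x k * eps) by rewrite rmorphM rhoeps mulr1.
      have [m [f [y [Gy ->]]]] := Gspan (x k).
      rewrite rmorph_sum; elim/big_ind: _ => // l _; rewrite iotaP; apply: (PZ).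
      have [u <-] := phiP _ (Gy l); exact: Pth.
    suff : rho (z - phi d%:M) = 0.
      by move/(splitting_inj rho pe sp ss)/eqP; rewrite mulrBl subr_eq0 => /eqP.
    apply/eqP; rewrite rmorphB subr_eq0 (nrz e pe L n rho sp).
    have -> : rho (phi d%:M) = (sg d)%:M by rewrite -sgP.
    rewrite -(det_matrix_ring th sg sgP th_span); apply/eqP; congr (_ %:M); congr determinant.
    by apply/eq_mxblockP => j k; rewrite /= /th0 hP rmorphM rhoeps mulr1.
  - by rewrite !mulrDr hu hv.
split; first by rewrite zE.
exists (\matrix_(j, k) phi (submxblock (\adj hm) j k)); split=> [j k|]; first by rewrite mxE.
apply/matrixP=> j k; rewrite !mxE zE.
have -> : phi d%:M *+ (j == k) = phi (submxblock (d%:M : 'M_(\sum_(i < b) a.+1)) j k).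
  rewrite -(mxdiagZ (p_ := fun=> a.+1)) mxblockK.
  by case: eqVneq => _; rewrite ?raddf0 // conform_mx_id.
rewrite -[d%:M]mul_adj_mx -[X in X *m hm](submxblockK (p_ := fun=> a.+1) (q_ := fun=> a.+1)).
rewrite mul_mxblock mxblockK raddf_sum; apply: eq_bigr => l _.
by rewrite mxE phiM hP -epsC mulrA phi_eps.
Qed.

(** * Nice orders *)

Section Nice.
Context {o : idomainType} {A : falgType {fraction o}}.
Local Notation tof := (@tofrac o : {rmorphism o -> {fraction o}}).

Lemma order_span (X : set A) : is_order {:A}%AS X ->
  forall x, exists (m : nat) (f : 'I_m -> {fraction o}) (y : 'I_m -> A),
    (forall k, X (y k)) /\ x = \sum_k f k *: y k.
Proof.
move=> /(is_orderP {:A}%AS)[_ _ _ [m [s [Xs sA]]]] x.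
exists m, (fun k => coord s k x), (fun k => s`_k); split=> [k|].
  by rewrite Xs; apply: (ospan_gen tof (fun k : 'I_m => s`_k)).
by apply: coord_span; rewrite sA memvf.
Qed.

Lemma order_central (X : set A) x : is_order {:A}%AS X ->
  (forall y, X y -> x * y = y * x) -> x \in 'Z({:A})%VS.
Proof.
move=> ordX xX; apply/memZP=> y; have [m [f [g [Xg ->]]]] := order_span X ordX y.
rewrite mulr_sumr mulr_suml; apply: eq_bigr => k _.
by rewrite -scalerAl -scalerAr xX.
Qed.

(** Decomposing 1 along the summands yields their units, which are central idempotents of A because
    Gamma spans A; the adjugates of the summands then add up. *)
Lemma nice_adjugate (Gamma : subringClosed A) b (H : 'M[A]_b) z :
  noetherian o -> semisimple_algebra A -> is_order {:A}%AS [set` Gamma] ->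
  is_nice [set` Gamma] -> (forall i j, H i j \in Gamma) -> is_nr H z ->
  has_adjugate [set` Gamma] 1 H z.
Proof.
move=> noeth ss ordGa [k [G [[GaG orth] Gtype]]] HGa nrz.
have G_group j : G j 0 /\ forall x, G j x -> G j (- x).
  have [[B [ordB _]]|[R [a [phi [_ _ <-]]]]] := Gtype j.
    have [_ sG _ _] := is_orderP _ _ ordB; have [G0 _ _] := sG.
    by split=> // x Gx; rewrite -[- x]add0r; apply: osubmoduleB.
  by split; [exists 0; rewrite ?raddf0 | move=> _ [u _ <-]; exists (- u); rewrite ?raddfN].
have GsubGa j x : G j x -> x \in Gamma.
  move=> Gx; apply/GaG; exists (fun i => if i == j then x else 0); split=> [i|].
    by case: eqVneq => [->|_] //; case: (G_group i).
  by rewrite -big_mkcond big_pred1_eq.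
have [eps [Geps sum_eps]] : exists y, (forall j, G j (y j)) /\ 1 = \sum_j y j.
  by apply/(GaG 1); rewrite /= rpred1.
have epsl j x : G j x -> eps j * x = x.
  move=> Gx; rewrite -[RHS]mul1r sum_eps mulr_suml (bigD1 j) //= big1 ?addr0 // => i ij.
  exact: orth ij _ _ (Geps i) Gx.
have epsr j x : G j x -> x * eps j = x.
  move=> Gx; rewrite -[RHS]mulr1 sum_eps mulr_sumr (bigD1 j) //= big1 ?addr0 // => i ij.
  by apply: (orth j i) => //; rewrite eq_sym.
have Gaeps j x : x \in Gamma -> G j (x * eps j) /\ eps j * x = x * eps j.
  move=> /GaG[g [Gg ->]]; rewrite mulr_suml mulr_sumr.
  have -> : \sum_i g i * eps j = g j.
    rewrite (bigD1 j) //= epsr // big1 ?addr0 // => i ij.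
    exact: (orth i j ij).
  rewrite (bigD1 j) //= epsl // big1 ?addr0 // => i ij.
  by apply: (orth j i) => //; rewrite eq_sym.
have c_eps j : central_idempotent (eps j).
  split; last exact: epsl.
  by apply: (order_central _ _ ordGa) => y /(Gaeps j)[].
have Gspan j x : exists (m : nat) (f : 'I_m -> {fraction o}) (y : 'I_m -> A),
    (forall k, G j (y k)) /\ x * eps j = \sum_k f k *: y k.
  have [m [f [y [Gay xE]]]] := order_span _ ordGa x.
  exists m, f, (fun k => y k * eps j); split=> [l|]; first by case: (Gaeps j _ (Gay l)).
  by rewrite xE mulr_suml; apply: eq_bigr => l _; rewrite scalerAl.
have adj j : has_adjugate (G j) (eps j) H z.
  have HG i l : G j (H i l * eps j) by case: (Gaeps j _ (HGa i l)).
  have [[B maxG]|matG] := Gtype j; last first.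
    exact: (matrix_ring_adjugate _ _ b H z ss matG (c_eps j) (Geps j) (Gspan j) (epsr j) HG nrz).
  apply: (maximal_order_adjugate noeth ss B) => // [x|x]; last exact: epsr.
  have [m [f [y [Gy ->]]]] := Gspan j x; apply: rpred_sum => l _; apply: rpredZ.
  have [_ _ _ [m' [s [Gs sB]]]] := is_orderP _ _ (proj1 maxG).
  move: (Gy l); rewrite Gs => -[c ->]; apply: rpred_sum => l' _; apply: rpredZ.
  by rewrite -sB; apply/memv_span/mem_nth; rewrite size_tuple.
have zE : z * 1 = \sum_j z * eps j by rewrite sum_eps mulr_sumr.
have /choice[K KP] : forall j, exists K : 'M[A]_b,
    (forall i l, G j (K i l)) /\ K *m H = (z * eps j)%:M by move=> j; case: (adj j).
split; first by rewrite zE; apply: rpred_sum => j _; apply: (GsubGa j); case: (adj j).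
exists (\sum_j K j); split=> [i l|].
  by rewrite summxE; apply: rpred_sum => j _; apply: (GsubGa j); case: (KP j) => GK _; apply: GK.
rewrite mulmx_suml zE raddf_sum; apply: eq_bigr => j _.
by case: (KP j).
Qed.

Lemma nrS_adjugate (Gamma : subringClosed A) b (H : 'M[subring Gamma]_b) :
  noetherian o -> semisimple_algebra A -> is_order {:A}%AS [set` Gamma] ->
  is_nice [set` Gamma] ->
  exists (z : subring Gamma) (K : 'M[subring Gamma]_b),
    [/\ val z = nrS H, nrS H \in 'Z({:A})%VS & K *m H = z%:M].
Proof.
(* If no element satisfies [is_nr], the value is the default 0 and K = 0 works. *)
move=> noeth ss ordGa nice; rewrite /nrS /nr; case: xgetP => [z _ nrz|_]; last first.
  by exists 0, 0; split; rewrite ?raddf0 ?mul0mx ?mem0v.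
have HGa i j : map_mx val H i j \in Gamma by rewrite mxE; apply: valP.
have [z1 [K [KGa KH]]] := nice_adjugate Gamma _ _ z noeth ss ordGa nice HGa nrz.
rewrite mulr1 in z1 KH.
exists (Subring z1), (\matrix_(i, j) Subring (KGa i j)); split=> //; first by case: nrz.
apply/matrixP=> i j; apply: val_inj; have /matrixP/(_ i j) := KH.
rewrite !mxE raddf_sum raddfMn /= => <-; apply: eq_bigr => l _.
by rewrite !mxE.
Qed.
End Nice.

(** * Fitting invariants *)

Lemma ring_span0 (R : pzRingType) (C G : set R) : ring_span C G 0.
Proof. by exists 0%N, (fun=> 0), (fun=> 0); split=> [[]//|]; rewrite big_ord0. Qed.

Lemma ring_spanD (R : pzRingType) (C G : set R) x y :
  ring_span C G x -> ring_span C G y -> ring_span C G (x + y).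
Proof.
move=> [m [c [g [cg ->]]]] [n [d [h [dh ->]]]]; exists (m + n)%N.
exists (fun i => match split i with inl k => c k | inr k => d k end).
exists (fun i => match split i with inl k => g k | inr k => h k end).
split=> [i|]; first by case: (split i).
rewrite big_split_ord; congr (_ + _); apply: eq_bigr => i _.
  by rewrite (unsplitK (inl i)).
by rewrite (unsplitK (inr i)).
Qed.

Lemma ring_spanS (R : pzRingType) (C C' G G' : set R) :
  C `<=` C' -> G `<=` G' -> ring_span C G `<=` ring_span C' G'.
Proof.
move=> CC' GG' x [n [c [g [cg xE]]]]; exists n, c, g; split=> // i.
by have [/CC' ? /GG' ?] := cg i.
Qed.

Lemma ring_span_set0 (R : pzRingType) (C : set R) x : ring_span C set0 x -> x = 0.
Proof.
by move=> [[|n] [c [g [cg ->]]]]; [rewrite big_ord0 | case: (cg ord0)].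
Qed.

Lemma linear_row {R : nzRingType} {M : lmodType R} {b} (p : {linear 'rV[R]_b -> M}) v :
  p v = \sum_i v 0 i *: p (delta_mx 0 i).
Proof. by rewrite {1}(row_sum_delta v) linear_sum; apply: eq_bigr => i _; rewrite linearZ. Qed.

Lemma linear_lift {R : nzRingType} {M : lmodType R} {b c}
    (p : {linear 'rV[R]_b -> M}) (q : {linear 'rV[R]_c -> M}) :
  (forall m, exists v, p v = m) -> exists Q : 'M_(c, b), forall w, p (w *m Q) = q w.
Proof.
move=> psurj; have /choice[u uP] : forall j, exists v, p v = q (delta_mx 0 j).
  by move=> j; apply: psurj.
exists (\matrix_j u j) => w; rewrite mulmx_sum_row linear_sum (linear_row q).
by apply: eq_bigr => j _; rewrite linearZ rowK uP.
Qed.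

Section FittingInvariant.
Context {F : fieldType} {A : falgType F} {S : subringClosed A}.

Lemma nr_eq b b' (H : 'M[A]_b) (H' : 'M[A]_b') :
  (forall (L : fieldType) n (rho : {rmorphism A -> 'M[L]_n.+1}),
     \det (blockrep rho H) = \det (blockrep rho H')) -> nr H = nr H'.
Proof.
move=> HH'; rewrite /nr; congr xget; apply/seteqP.
split=> z [zZ zP]; split=> // e pe L n rho sp; rewrite (zP e pe L n rho sp);
  by congr (_ %:M); have := HH' L n rho.
Qed.

Lemma nrS_lblock b1 b2 (X : 'M[subring S]_b1) (Z : 'M_(b2, b1)) :
  nrS (block_mx X 0 Z 1%:M) = nrS X.
Proof.
apply: nr_eq => L n rho; rewrite map_block_mx map_mx0 map_mx1.
exact: det_blockrep_lblock.
Qed.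

Lemma nrS_rblock b1 b2 (Y : 'M_(b1, b2)) (X : 'M[subring S]_b2) :
  nrS (block_mx 1%:M Y 0 X) = nrS X.
Proof.
apply: nr_eq => L n rho; rewrite map_block_mx map_mx0 map_mx1.
exact: det_blockrep_rblock.
Qed.

Lemma Fit0 a b (h : 'M[subring S]_(a, b)) : Fit h 0.
Proof. by rewrite /Fit; case: ifP => // _; apply: ring_span0. Qed.

Lemma FitD a b (h : 'M[subring S]_(a, b)) x y : Fit h x -> Fit h y -> Fit h (x + y).
Proof.
rewrite /Fit; case: ifP => _; first exact: ring_spanD.
by move=> -> ->; rewrite /= addr0.
Qed.

Lemma Fit_sub a b a' b' (h : 'M[subring S]_(a, b)) (h' : 'M[subring S]_(a', b')) :
  ((b <= a)%N -> (b' <= a')%N /\ forall f : 'I_b -> 'I_a, {homo f : i j / (i < j)%N} ->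
     exists2 f' : 'I_b' -> 'I_a', {homo f' : i j / (i < j)%N} &
       nrS (rowsub f' h') = nrS (rowsub f h)) ->
  Fit h `<=` Fit h'.
Proof.
rewrite {1}/Fit; case: ifP => ba; last by move=> _ _ ->; apply: Fit0.
move=> /(_ isT)[ba' ff']; rewrite /Fit ba'; apply: ring_spanS => // z [f [fmono ->]].
by have [f' f'mono <-] := ff' f fmono; exists f'.
Qed.

Context {M : lmodType (subring S)}.

(* Both presentations are refined by the obvious presentation of               *)
(* [(p1, p2) : R^(b1 + b2) -> M], whose relations are generated by either of   *)
(* the two blocks of rows.                                                     *)
Lemma Fit_directed a1 b1 (h1 : 'M[subring S]_(a1, b1)) a2 b2 (h2 : 'M[subring S]_(a2, b2)) :
  presents M h1 -> presents M h2 ->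
  exists a b (h : 'M[subring S]_(a, b)),
    [/\ presents M h, Fit h1 `<=` Fit h & Fit h2 `<=` Fit h].
Proof.
move=> [p1 [p1surj p1ker]] [p2 [p2surj p2ker]].
have [Q QP] := linear_lift p1 p2 p1surj; have [P PP] := linear_lift p2 p1 p2surj.
exists (a1 + b2 + (b1 + a2))%N, (b1 + b2)%N.
exists (col_mx (block_mx h1 0 (- Q) 1%:M) (block_mx 1%:M (- P) 0 h2)); split.
- pose p (v : 'rV[subring S]_(b1 + b2)) := p1 (lsubmx v) + p2 (rsubmx v).
  have pL : linear p by move=> c u v; rewrite /p !linearP /= addrACA scalerDr.
  pose pl : {linear 'rV[subring S]_(b1 + b2) -> M} :=
    HB.pack p (GRing.isLinear.Build (subring S) 'rV[subring S]_(b1 + b2) M *:%R p pL).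
  exists pl; split=> [m|v].
    by have [v <-] := p1surj m; exists (row_mx v 0); rewrite /= /p row_mxKl row_mxKr linear0 addr0.
  rewrite /= /p; split=> [pv|[w ->]].
    have : p1 (lsubmx v + rsubmx v *m Q) = 0 by rewrite linearD QP.
    case/p1ker=> w wE; exists (row_mx (row_mx w (rsubmx v)) 0).
    rewrite mul_row_col mul0mx addr0 mul_row_block mulmx0 add0r mulmx1 mulmxN -wE addrK.
    by rewrite hsubmxK.
  have [w1 [y [x [w2 ->]]]] : exists w1 y x w2, w = row_mx (row_mx w1 y) (row_mx x w2).
    exists (lsubmx (lsubmx w)), (rsubmx (lsubmx w)), (lsubmx (rsubmx w)), (rsubmx (rsubmx w)).
    by rewrite !hsubmxK.
  rewrite mul_row_col !mul_row_block !mulmx0 !mulmx1 !add0r !addr0 add_row_mx.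
  rewrite row_mxKl row_mxKr !mulmxN !linearD !linearN QP PP.
  have -> : p1 (w1 *m h1) = 0 by apply/p1ker; exists w1.
  have -> : p2 (w2 *m h2) = 0 by apply/p2ker; exists w2.
  by rewrite add0r addr0 [- _ + _]addrC -[X in _ + X]opprB subrr.
- apply: Fit_sub => ba; split=> [|f fmono].
    by rewrite -addnA leq_add // (leq_trans _ (leq_addr _ _)).
  (* Rows f of (h1 0) and all rows of (-Q 1) form a block-triangular matrix with the reduced norm of
     the chosen minor of h1; the other inclusion is symmetric. *)
  pose f' (k : 'I_(b1 + b2)) : 'I_(a1 + b2 + (b1 + a2)) :=
    match split k with inl i => lshift _ (lshift _ (f i)) | inr j => lshift _ (rshift _ j) end.
  exists f' => [k l|].
    rewrite /f'; case: splitP => i ik; case: splitP => j jl /=; rewrite ik jl.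
    + exact: fmono.
    + by move=> _; apply: leq_trans (ltn_ord _) (leq_addr _ _).
    + by move=> /(leq_ltn_trans (leq_addr _ _)); rewrite ltnNge ltnW.
    + by rewrite !ltn_add2l.
  rewrite -(nrS_lblock _ _ (rowsub f h1) (- Q)); congr nrS; apply/row_matrixP=> k.
  rewrite row_rowsub -[k]splitK /f' unsplitK; case: (split k) => i /=.
    by rewrite [LHS]rowKu [LHS]rowKu [RHS]rowKu !row_row_mx row_rowsub !row0.
  by rewrite [LHS]rowKu [LHS]rowKd [RHS]rowKd.
- apply: Fit_sub => ba; split=> [|f fmono].
    by rewrite [leqRHS]addnC leq_add ?leq_addr ?leq_addl.
  pose f' (k : 'I_(b1 + b2)) : 'I_(a1 + b2 + (b1 + a2)) :=
    match split k with inl i => rshift _ (lshift _ i) | inr j => rshift _ (rshift _ (f j)) end.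
  exists f' => [k l|].
    rewrite /f'; case: splitP => i ik; case: splitP => j jl /=; rewrite ik jl !ltn_add2l //.
    + by move=> _; apply: leq_trans (ltn_ord _) (leq_addr _ _).
    + by move=> /(leq_ltn_trans (leq_addr _ _)); rewrite ltnNge ltnW.
    + exact: fmono.
  rewrite -(nrS_rblock _ _ (- P) (rowsub f h2)); congr nrS; apply/row_matrixP=> k.
  rewrite row_rowsub -[k]splitK /f' unsplitK; case: (split k) => i /=.
    by rewrite [LHS]rowKd [LHS]rowKu [RHS]rowKu.
  by rewrite [LHS]rowKd [LHS]rowKd [RHS]rowKd !row_row_mx row_rowsub !row0.
Qed.
End FittingInvariant.

(** * Extension of scalars applied to a presentation *)

Section TensorPresentation.
Context {R S : nzRingType} (f : {rmorphism R -> S}) {M : lmodType R}.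
Local Notation T := (tensor f M).

Lemma pure_tensorDl a b (m : M) : pure_tensor f (a + b) m = pure_tensor f a m + pure_tensor f b m.
Proof. by rewrite [RHS]tens_addE; apply/tens_classP/tens_Dl. Qed.

Lemma pure_tensorDr a (m n : M) : pure_tensor f a (m + n) = pure_tensor f a m + pure_tensor f a n.
Proof. by rewrite [RHS]tens_addE; apply/tens_classP/tens_Dr. Qed.

Lemma pure_tensor_bal a r (m : M) : pure_tensor f (a * f r) m = pure_tensor f a (r *: m).
Proof. exact/tens_classP/tens_bal. Qed.

Lemma pure_tensorZ a b (m : M) : a *: pure_tensor f b m = pure_tensor f (a * b) m.
Proof. exact: tens_scaleE. Qed.

Lemma tens_class_sum (s : seq (S * M)) : tens_class f s = \sum_(p <- s) pure_tensor f p.1 p.2 :> T.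
Proof.
elim: s => [|[a m] s IH]; first by rewrite big_nil.
by rewrite big_cons -IH [RHS]tens_addE.
Qed.

(** Right exactness of the tensor product. For the kernel, an inverse modulo the relations is
    defined on formal sums by lifting each m to the free module; the generating congruences respect
    it. *)
Lemma tensor_presentation a b (h : 'M[R]_(a, b)) (p : {linear 'rV[R]_b -> M}) :
  (forall m, exists v, p v = m) -> (forall v, p v = 0 <-> exists w : 'rV_a, v = w *m h) ->
  exists q : {linear 'rV[S]_b -> T},
    (forall t, exists v, q v = t) /\
    (forall v, q v = 0 <-> exists w : 'rV_a, v = w *m map_mx f h).
Proof.
move=> psurj pker.
have pure_sum c I (r : seq I) (F : I -> M) :
    pure_tensor f c (\sum_(i <- r) F i) = \sum_(i <- r) pure_tensor f c (F i).
  apply: (big_morph (pure_tensor f c)) => [x y|]; first exact: pure_tensorDr.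
  by apply: (addrI (pure_tensor f c 0)); rewrite -pure_tensorDr !addr0.
pose q0 (v : 'rV[S]_b) : T := \sum_i pure_tensor f (v 0 i) (p (delta_mx 0 i)).
have q0L : linear q0.
  move=> c u v; rewrite /q0 scaler_sumr -big_split; apply: eq_bigr => i _.
  by rewrite !mxE pure_tensorDl pure_tensorZ.
pose q : {linear 'rV[S]_b -> T} :=
  HB.pack q0 (GRing.isLinear.Build S 'rV[S]_b T *:%R q0 q0L).
have q_pure c v : q (c *: map_mx f v) = pure_tensor f c (p v).
  rewrite /= /q0 linear_row pure_sum; apply: eq_bigr => i _.
  by rewrite !mxE pure_tensor_bal.
exists q; split.
  elim/tens_ind=> s; rewrite tens_class_sum; elim: s => [|[c m] s [v vE]].
    by exists 0; rewrite big_nil linear0.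
  have [u uE] := psurj m; exists (c *: map_mx f u + v).
  by rewrite big_cons -vE linearD q_pure uE.
pose im (v : 'rV[S]_b) := exists w : 'rV_a, v = w *m map_mx f h.
have imD u v : im u -> im v -> im (u + v).
  by move=> [x ->] [y ->]; exists (x + y); rewrite mulmxDl.
have imZ c u : im u -> im (c *: u) by move=> [x ->]; exists (c *: x); rewrite scalemxAl.
have im0 : im 0 by exists 0; rewrite mul0mx.
have imN u : im u -> im (- u) by rewrite -scaleN1r; apply: imZ.
have im_ker v : p v = 0 -> im (map_mx f v).
  by case/pker=> w ->; exists (map_mx f w); rewrite map_mxM.
have /choice[l lP] := psurj.
pose ev (s : seq (S * M)) := \sum_(x <- s) x.1 *: map_mx f (l x.2).
have evP s t : tens_eq f s t -> im (ev s - ev t).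
  rewrite /ev; elim=> {s t}.
  - by move=> s; rewrite subrr.
  - by move=> s t _ /imN; rewrite opprB.
  - by move=> s t u _ st _ tu; have := imD _ _ st tu; rewrite addrA subrK.
  - by move=> s s' t t' _ hs _ ht; have := imD _ _ hs ht; rewrite !big_cat opprD addrACA.
  - by move=> s t; rewrite !big_cat /= addrC subrr.
  - by move=> m; rewrite big_seq1 big_nil scale0r subr0.
  - by move=> c d m; rewrite !big_cons !big_nil !addr0 -scalerDl subrr.
  - move=> c m n; rewrite !big_cons !big_nil !addr0 -scalerDr -scalerBr -map_mxD -map_mxB.
    by apply/imZ/im_ker; rewrite linearB linearD !lP subrr.
  - move=> c r m; rewrite !big_seq1 /= -scalerA -map_mxZ -scalerBr -map_mxB.
    by apply/imZ/im_ker; rewrite linearB linearZ !lP subrr.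
move=> v; split=> [qv|[w ->]]; last first.
  rewrite mulmx_sum_row linear_sum big1 // => k _; rewrite -map_row q_pure.
  have -> : p (row k h) = 0 by apply/pker; exists (delta_mx 0 k); rewrite -rowE.
  by apply: (addrI (pure_tensor f (w 0 k) 0)); rewrite -pure_tensorDr !addr0.
pose s := [seq (v 0 i, p (delta_mx 0 i)) | i <- enum 'I_b].
have : tens_eq f s [::].
  apply/tens_classP; rewrite tens_class_sum big_map big_enum; exact: qv.
move/evP; rewrite /ev big_nil subr0 big_map big_enum /= => im_s.
(* Each basis vector differs from the chosen lift of its image by an element of ker p, that is, by a
   relation. *)
rewrite -[v](subrK (\sum_i v 0 i *: map_mx f (l (p (delta_mx 0 i))))); apply: (imD) => //.
rewrite {1}(row_sum_delta v) -sumrB; apply: (big_ind im im0 imD) => i _.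
rewrite -scalerBr -(map_delta_mx f) -map_mxB; apply/imZ/im_ker.
by rewrite linearB lP subrr.
Qed.

End TensorPresentation.

(** * Annihilation and the greatest Fitting invariant over a nice order *)

Section NiceOrder.
Context {o : idomainType} {A : falgType {fraction o}} {Gamma : subringClosed A}.
Local Notation tof := (@tofrac o : {rmorphism o -> {fraction o}}).
Hypotheses (noeth : noetherian o) (ss : semisimple_algebra A)
  (ordGa : is_order {:A}%AS [set` Gamma]) (nice : is_nice [set` Gamma]).

Lemma centre_order x : centre Gamma x <-> x \in Gamma /\ x \in 'Z({:A})%VS.
Proof.
split=> -[Gax xP]; split=> //; last by move=> y _; apply: (memZP _ xP).
exact: (order_central _ _ ordGa).
Qed.

Lemma order_scale c x : x \in Gamma -> tof c *: x \in Gamma.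
Proof. by have [_ [_ _ GaZ] _ _] := is_orderP _ _ ordGa; apply: GaZ. Qed.

Lemma calU_nice x : calU Gamma x -> x \in Gamma /\ x \in 'Z({:A})%VS.
Proof.
move=> [n [c [g [cg ->]]]].
have cgP i : c i * g i \in Gamma /\ c i * g i \in 'Z({:A})%VS.
  have [/centre_order[Gac Zc] [b [H [_ ->]]]] := cg i.
  have [z [K [zE Zz _]]] := nrS_adjugate Gamma b H noeth ss ordGa nice.
  split; first by rewrite rpredM // -zE; apply: valP.
  by apply/memZP=> y; rewrite -mulrA (memZP _ Zz) mulrA (memZP _ Zc) mulrA.
by split; apply: rpred_sum => i _; case: (cgP i).
Qed.

Lemma Fit_scale a b (h : 'M[subring Gamma]_(a, b)) c x : Fit h x -> Fit h (tof c *: x).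
Proof.
rewrite /Fit; case: ifP => _; last by move=> ->; rewrite /= scaler0.
move=> [n [u [g [ug ->]]]]; exists n, (fun i => tof c *: u i), g; split=> [i|].
  have [[m [d [k [dk ->]]]] gP] := ug i; split=> //.
  exists m, (fun j => tof c *: d j), k; split=> [j|].
    have [/centre_order[Gad Zd] kP] := dk j; split=> //; apply/centre_order; split.
      exact: order_scale.
    exact: rpredZ.
  by rewrite scaler_sumr; apply: eq_bigr => j _; rewrite scalerAl.
by rewrite scaler_sumr; apply: eq_bigr => i _; rewrite scalerAl.
Qed.

Context {T : lmodType (subring Gamma)}.

(** For t = p(v) and a minor H of [h], v nr(H) = v K H is a combination of rows of [h], so nr(H) t =
    0. *)
Lemma Fit_annihilates a b (h : 'M[subring Gamma]_(a, b)) x : presents T h -> Fit h x ->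
  exists y : subring Gamma, [/\ x = val y, x \in 'Z({:A})%VS & forall t : T, y *: t = 0].
Proof.
move=> [p [psurj pker]]; rewrite /Fit; case: ifP => [ba|_ ->]; last first.
  by exists 0; split=> [||t]; rewrite ?raddf0 ?mem0v ?scale0r.
move=> [n [u [g [ug ->]]]].
have /choice[y yP] : forall i, exists y : subring Gamma,
    [/\ u i * g i = val y, u i * g i \in 'Z({:A})%VS & forall t : T, y *: t = 0].
  move=> i; have [/calU_nice[Gau Zu] [f [_ ->]]] := ug i.
  have [z [K [zE Zz KH]]] := nrS_adjugate Gamma _ (rowsub f h) noeth ss ordGa nice.
  exists (Subring Gau * z); split=> [||t]; first by rewrite /= -zE.
    by apply/memZP=> w; rewrite -mulrA (memZP _ Zz) mulrA (memZP _ Zu) mulrA.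
  rewrite -scalerA; suff -> : z *: t = 0 by rewrite scaler0.
  have [v <-] := psurj t; rewrite -linearZ; apply/pker.
  exists (v *m K *m rowsub f 1%:M).
  rewrite -!mulmxA mul_rowsub_mx mul1mx KH.
  apply/rowP=> j; rewrite !mxE (bigD1 j) //= big1 ?addr0.
    rewrite mxE eqxx mulr1n; apply: val_inj; rewrite /= zE.
    exact: (memZP _ Zz).
  by move=> k kj; rewrite mxE (negPf kj) mulr0.
exists (\sum_i y i); split=> [||t].
- by rewrite raddf_sum; apply: eq_bigr => i _; case: (yP i).
- by apply: rpred_sum => i _; case: (yP i).
- by rewrite scaler_suml big1 // => i _; case: (yP i).
Qed.

(** By directedness the union of all invariants is an o-submodule. It lies in Gamma, hence is
    finitely generated, and directedness again puts all generators into one invariant. *)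
Lemma greatest_Fitting_invariant X0 : Fitting_invariant T X0 ->
  exists X, Fitting_invariant T X /\ forall Y, Fitting_invariant T Y -> Y `<=` X.
Proof.
move=> [a0 [b0 [h0 [h0P _]]]].
pose U : set A := [set x | exists a b (h : 'M[subring Gamma]_(a, b)), presents T h /\ Fit h x].
have sU : osubmodule tof U.
  split; first by exists a0, b0, h0; split=> //; apply: Fit0.
    move=> x y [a1 [b1 [h1 [p1 x1]]]] [a2 [b2 [h2 [p2 y2]]]].
    have [a [b [h [hP h1h h2h]]]] := Fit_directed a1 b1 h1 a2 b2 h2 p1 p2.
    by exists a, b, h; split=> //; apply: FitD; [apply: h1h | apply: h2h].
  by move=> c x [a [b [h [hP hx]]]]; exists a, b, h; split=> //; apply: Fit_scale.
have [_ _ _ [m [s [Gas _]]]] := is_orderP _ _ ordGa.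
have [r [w [Uw wU]]] : exists r (w : 'I_r -> A), (forall k, U (w k)) /\ U `<=` ospan tof w.
  apply: (fg_of_injection tof tof (idfun : {additive A -> A}) U (fun k : 'I_m => s`_k)) => //.
  move=> x [a [b [h [hP hx]]]] /=; have [y [-> _ _]] := Fit_annihilates a b h x hP hx.
  by rewrite -Gas; apply: valP.
have [a [b [h [hP hw]]]] : exists a b (h : 'M[subring Gamma]_(a, b)),
    presents T h /\ forall k, k \in enum 'I_r -> Fit h (w k).
  elim: (enum 'I_r) => [|k ks [a1 [b1 [h1 [p1 hks]]]]]; first by exists a0, b0, h0.
  have [a2 [b2 [h2 [p2 wk]]]] := Uw k.
  have [a [b [h [hP h1h h2h]]]] := Fit_directed a1 b1 h1 a2 b2 h2 p1 p2.
  exists a, b, h; split=> // l; rewrite inE => /predU1P[->|lks]; first exact: h2h.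
  by apply/h1h/hks.
exists (Fit h); split; first by exists a, b, h.
move=> _ [a' [b' [h' [hP' ->]]]] x hx.
have [|c ->] := wU x; first by exists a', b', h'.
apply: (big_ind (Fit h)) => [|y z|k _]; first exact: Fit0.
  exact: FitD.
by apply/Fit_scale/hw; rewrite mem_enum.
Qed.

(** A greatest invariant is the unique maximal one, so [xget] selects it and not the default. *)
Lemma Fitmax_greatest X : Fitting_invariant T X -> X `<=` Fitmax T.
Proof.
move=> XF; have [Z [ZF Zmax]] := greatest_Fitting_invariant X XF.
have Zmax_max : maximal_Fitting_invariant T Z.
  by split=> // Y /Zmax YZ ZY; apply/seteqP.
rewrite /Fitmax; case: xgetP => [Y _ [_ Yuniq]|noY].
  by rewrite -(Yuniq Z Zmax_max); apply: Zmax.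
exfalso; apply: (noY Z); split=> // Y [YF Ymax].
by apply/esym/Ymax => //; apply: Zmax.
Qed.

End NiceOrder.

Lemma Fitmax_invariant {F : fieldType} {A : falgType F} {S : subringClosed A}
    (M : lmodType (subring S)) : Fitmax M = set0 \/ Fitting_invariant M (Fitmax M).
Proof. by rewrite /Fitmax; case: xgetP => [X _ [[XF _] _]|_]; [right | left]. Qed.

(** * Comparison of Lambda and Gamma *)

Section Extension.
Context {o : idomainType} {A : falgType {fraction o}} {Lambda Gamma : subringClosed A}.
Hypotheses (ordLa : is_order {:A}%AS [set` Lambda]) (ordGa : is_order {:A}%AS [set` Gamma])
  (sub : {subset Lambda <= Gamma}).

Lemma map_incl_val a b (h : 'M[subring Lambda]_(a, b)) :
  map_mx val (map_mx (incl sub) h) = map_mx val h.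
Proof. by apply/matrixP=> i j; rewrite !mxE. Qed.

(** Reduced norms depend only on the entries in A. The coefficients also grow: both orders span A,
    so the centre of Lambda lies in that of Gamma, and invertible matrices stay invertible. *)
Lemma Fit_incl a b (h : 'M[subring Lambda]_(a, b)) : Fit h `<=` Fit (map_mx (incl sub) h).
Proof.
rewrite /Fit; case: ifP => _; last by move=> x.
apply: ring_spanS; last first.
  by move=> _ [f [fmono ->]]; exists f; split=> //; rewrite /nrS -map_mxsub map_incl_val.
apply: ring_spanS => [x|_ [b' [H [[K [HK KH]] ->]]]].
  move/(centre_order ordLa) => [Lax Zx]; apply/(centre_order ordGa); split=> //.
  exact: sub.
exists b', (map_mx (incl sub) H); split; last by rewrite /nrS map_incl_val.
by exists (map_mx (incl sub) K); rewrite -!map_mxM HK KH !map_mx1.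
Qed.

(** The map g (x) m |-> (c g) m is well defined on the tensor product since c Gamma lies in Lambda.
    It sends y (1 (x) m) = 0 to (c y) m. *)
Lemma conductor_annihilates (M : lmodType (subring Lambda)) c (y : subring Gamma) :
  central_conductor Gamma Lambda c -> val y \in 'Z({:A})%VS ->
  (forall t : tensor (incl sub) M, y *: t = 0) -> central_annihilator M (c * val y).
Proof.
move=> [/(centre_order ordGa)[Gac Zc] cGa] Zy yT.
have La : c * val y \in Lambda by apply/cGa/valP.
exists (Subring La); split=> //.
  apply/(centre_order ordLa); split=> //.
  by apply/memZP=> w; rewrite -mulrA (memZP _ Zy) mulrA (memZP _ Zc) mulrA.
move=> m; pose beta (g : subring Gamma) (m : M) : M := Subring (cGa _ (valP g)) *: m.
have [g [[gB gE] _]] : exists! g : tensor (incl sub) M -> M, zmod_morphism g /\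
    (forall a m, g (pure_tensor (incl sub) a m) = beta a m).
  apply: tensor_universal => [a b n|a n n'|a r n].
  - by rewrite /beta -scalerDl; congr (_ *: _); apply: val_inj; rewrite /= mulrDr.
  - by rewrite /beta scalerDr.
  - by rewrite /beta scalerA; congr (_ *: _); apply: val_inj; rewrite /= mulrA.
have gym : g (pure_tensor (incl sub) y m) = 0.
  have -> : pure_tensor (incl sub) y m = 0.
    by have := yT (pure_tensor (incl sub) 1 m); rewrite pure_tensorZ mulr1.
  by have := gB 0 0; rewrite !subrr.
rewrite -gym gE; congr (_ *: _); exact: val_inj.
Qed.

End Extension.

Theorem theorem6p10 (o : idomainType) (ho : Fitting_domain o)
    (A : falgType {fraction o}) (Lambda Gamma : subringClosed A)
    (hLambda : Fitting_order Lambda) (hGamma : Fitting_order Gamma)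
    (hsub : {subset Lambda <= Gamma}) (hnice : is_nice [set` Gamma])
    (M : lmodType (subring Lambda)) (hM : finitely_generated M) :
  ring_span (central_conductor Gamma Lambda) (Fitmax M)
    `<=` ring_span (central_conductor Gamma Lambda) (Fitmax (tensor (incl hsub) M))
  /\
  ring_span (central_conductor Gamma Lambda) (Fitmax (tensor (incl hsub) M))
    `<=` central_annihilator M.
Proof.
have [noeth _ _] := ho.
have [_ ordLa] := hLambda; have [[ss _] ordGa] := hGamma.
split.
  have [->|[a [b [h [[p [psurj pker]] ->]]]]] := Fitmax_invariant M.
    (* If [Fitmax M] is the default empty set, its product with the conductor is 0. *)
    by move=> x /ring_span_set0->; apply: ring_span0.
  apply: ring_spanS => //; apply: subset_trans (Fit_incl ordLa ordGa hsub a b h) _.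
  apply: Fitmax_greatest => //; exists a, b, (map_mx (incl hsub) h); split=> //.
  exact: (tensor_presentation (incl hsub) a b h p).
have ann0 : central_annihilator M 0.
  exists 0; split=> [||m]; [by rewrite raddf0 | | by rewrite scale0r].
  by apply/(centre_order ordLa); rewrite rpred0 mem0v.
have [->|[a [b [h [hP ->]]]]] := Fitmax_invariant (tensor (incl hsub) M).
  by move=> x /ring_span_set0->.
move=> _ [n [c [x [cx ->]]]]; apply: (big_ind (central_annihilator M)) => // [u v|i _].
  move=> [y [-> [yLa Zy] yM]] [z [-> [zLa Zz] zM]]; exists (y + z); split=> //.
  - split; first exact: rpredD.
    by move=> w wLa; rewrite mulrDl mulrDr Zy // Zz.
  - by move=> m; rewrite scalerDl yM zM addr0.
have [ci xi] := cx i.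
have [y [xE Zy yT]] := Fit_annihilates noeth ss ordGa hnice a b h (x i) hP xi.
by rewrite xE; apply: conductor_annihilates => //; rewrite -xE.
Qed.
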